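(* Let $n\ge 1$ and $y>1$. Then $$\sigma_n(y)=4\arccos\frac{1}{y^{1/(2n)}}.$$ Moreover, for each $k=0,1,\dots,2n-1$ the polynomial $$f_{n,k}(t)=(-1)^kT_n\!\left(y^{1/n}\cos\!\left(t-\frac{\pi k}{n}\right)-y^{1/n}+1\right)$$ belongs to $\mathcal{F}_n(y)$ and satisfies $\mu(f_{n,k})=\sigma_n(y)$; and these $2n$ polynomials are the only elements $f\in\mathcal{F}_n(y)$ with $\mu(f)=\sigma_n(y)$.
   Context: $\mathcal{F}_n$ denotes the set of real trigonometric polynomials $f(t)=\frac{a_0}{2}+\sum_{k=1}^n(a_k\cos kt+b_k\sin kt)$ of order at most $n$ with real coefficients ($\mathcal{F}_{n-1}$ likewise for order $\le n-1$). $\mathbb{T}$ is the torus $[0,2\pi)$ with endpoints identified, with Lebesgue measure $\mathrm{mes}$. For $f\in\mathcal{F}_n$, $\mu(f)=\mathrm{mes}\{t\in\mathbb{T}:|f(t)|\ge 1\}$. For $y\ge 0$, $\mathcal{F}_n(y)=\{y\cos nt+f_{n-1}(t): f_{n-1}\in\mathcal{F}_{n-1}\}$ and $\sigma_n(y)=\inf\{\mu(f):f\in\mathcal{F}_n(y)\}$. $T_n$ is the Chebyshev polynomial of the first kind, $T_n(x)=\cos(n\arccos x)$ for $x\in[-1,1]$. *)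

(* Defs.v *)
From Stdlib Require Import Reals Lra.
Open Scope R_scope.

Fixpoint trig_sum (n : nat) (a b : nat -> R) (t : R) : R :=
  match n with
  | O => 0
  | S m => trig_sum m a b t + (a (S m) * cos (INR (S m) * t) + b (S m) * sin (INR (S m) * t))
  end.

Definition trig_poly (n : nat) (a b : nat -> R) (t : R) : R :=
  a O / 2 + trig_sum n a b t.

Definition in_Fny (n : nat) (y : R) (f : R -> R) : Prop :=
  exists a b : nat -> R, forall t, f t = y * cos (INR n * t) + trig_poly (n - 1) a b t.

Definition ind_ge1 (f : R -> R) (t : R) : R :=
  if Rle_dec 1 (Rabs (f t)) then 1 else 0.

(* mu f = m : the measure of {t in [0,2pi) : |f t| >= 1} equals m.
   For trigonometric polynomials this set is a finite union of intervals,
   so its Lebesgue measure equals the Riemann integral of its indicator. *)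
Definition mu_is (f : R -> R) (m : R) : Prop :=
  exists pr : Riemann_integrable (ind_ge1 f) 0 (2 * PI), RiemannInt pr = m.

Definition is_glb (E : R -> Prop) (m : R) : Prop :=
  (forall x, E x -> m <= x) /\ (forall b, (forall x, E x -> b <= x) -> b <= m).

Definition is_sigma (n : nat) (y : R) (s : R) : Prop :=
  is_glb (fun x => exists f, in_Fny n y f /\ mu_is f x) s.

Fixpoint cheb (n : nat) (x : R) : R :=
  match n with
  | O => 1
  | S m => match m with
           | O => x
           | S p => 2 * x * cheb m x - cheb p x
           end
  end.

Definition fnk (n : nat) (y : R) (k : nat) (t : R) : R :=
  (-1) ^ k * cheb n (Rpower y (/ INR n) * cos (t - PI * INR k / INR n)
                     - Rpower y (/ INR n) + 1).

(* Main.v *)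
(* Write E = {|f| <= 1} and L for its length; the claim is y sin(L/4)^(2n) <= 1.

   Let c be a maximum point of |f| and measure angles from c + pi. For q < 1 close to 1 let tau be given
   by sin(tau(t)/2) = q sin(t/2); it maps the circle, folded at c, onto an arc centred at c + pi. With d^2 = 1 - q^2,
   the function f o tau is a trigonometric polynomial of order n up to an error O(d^3), precisely because
   f'(c) = 0, and the leading coefficient is multiplied by exactly q^(2n). The density of tau^-1
   increases with the distance from c + pi, so among sets of given length the preimage is shortest for
   the arc centred at c + pi, for which sin(L/4) gets divided by q. Hence y sin(L/4)^(2n) does not
   decrease, up to a factor 1 + O(d^3). About log(y) / (n d^2) steps bring y down to 1, where the bound is
   trivial; the accumulated error O(d) vanishes in the limit.

   If equality holds then E must be the arc centred at c + pi, since otherwise a single step gains a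
   factor 1 + const * d^2. When |f| <= 1 on that arc, take q = sin(L/4) and multiply the odd part of f o tau by
   cos(t/2) / cos(tau/2), which lies in [0, 1]: the result is exactly a trigonometric polynomial, bounded
   by 1 on the whole circle, with leading coefficients q^(2n) A and q^(2n-1) B if those of f are A and B.
   As A^2 + B^2 = y^2 = q^(-4n), this forces B = 0, so the result is +-cos(n t) and f is +-T_n. *)

Require Import Defs.
From Stdlib Require Import Reals ZArith Lra Lia List FunctionalExtensionality.
From Coquelicot Require Import Coquelicot.
Import ListNotations.
Open Scope R_scope.

(** * Trigonometric polynomials and their leading harmonic *)

(** The obstacle is the odd part of f o tau. Each cos (k tau) is exactly a trigonometric polynomial,
    because cos tau = q^2 cos t + 1 - q^2, but sin (k tau) carries the factor z = cos (tau/2), which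
    is not one. Replacing z by cos (t/2) costs O(d) near the fold, too much for 1/d^2 steps. Since
    f'(c) = 0, multiples of sin tau can be subtracted from the sines so that they cancel in the sum
    and every odd term contains sin tau (1 + cos tau) = 4 q sin (t/2) z^3; a suitable replacement of
    the cube costs only O(d^3). Dividing each new polynomial by 1 + O(d^3) keeps a single bound M
    for all iterates, hence the same constants in every step.

    A step needs E to lie in the image of tau. At its maximum |f| is at least the leading amplitude,
    so this holds while y exceeds 1 by more than O(d); the iteration stops there, where sin <= 1
    suffices.

    For a general f, E is never determined exactly. Finite lists of disjoint intervals inside E,
    with total length as close as desired to that of E, are extracted from the Riemann integral, and
    their images under the inverse of tau are again such lists. *)

Definition trig (n : nat) (f : R -> R) : Prop :=
  exists a b : nat -> R, forall t, f t = trig_poly n a b t.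

(* The index is shifted by one: [lead m] speaks about order [m + 1]. *)
Definition lead (m : nat) (A B : R) (f : R -> R) : Prop :=
  exists g, trig m g /\
    forall t, f t = A * cos (INR (S m) * t) + B * sin (INR (S m) * t) + g t.

Lemma trig_sum_ext n a b a' b' t :
  (forall k, (1 <= k <= n)%nat -> a k = a' k /\ b k = b' k) ->
  trig_sum n a b t = trig_sum n a' b' t.
Proof.
  induction n as [|n IH]; intros H; [reflexivity|]. cbn [trig_sum].
  rewrite IH by (intros; apply H; lia).
  destruct (H (S n)) as [-> ->]; [lia|reflexivity].
Qed.

Lemma trig_sum_lin n a b a' b' c t :
  trig_sum n (fun k => a k + c * a' k) (fun k => b k + c * b' k) t
  = trig_sum n a b t + c * trig_sum n a' b' t.
Proof.
  induction n as [|n IH]; [simpl; ring|]. cbn [trig_sum]. rewrite IH. ring.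
Qed.

Lemma trig_sum_0 n t : trig_sum n (fun _ => 0) (fun _ => 0) t = 0.
Proof. induction n as [|n IH]; [reflexivity|]. cbn [trig_sum]. rewrite IH. ring. Qed.

Lemma trig_lin n f g c : trig n f -> trig n g -> trig n (fun t => f t + c * g t).
Proof.
  intros [a [b H]] [a' [b' H']].
  exists (fun k => a k + c * a' k), (fun k => b k + c * b' k). intros t.
  unfold trig_poly. rewrite trig_sum_lin, H, H'. unfold trig_poly. field.
Qed.

Lemma trig_const n c : trig n (fun _ => c).
Proof.
  exists (fun k => match k with O => 2 * c | _ => 0 end), (fun _ => 0). intros t.
  unfold trig_poly. rewrite (trig_sum_ext _ _ _ (fun _ => 0) (fun _ => 0)).
  - rewrite trig_sum_0. field.
  - intros [|k] Hk; [lia|]. auto.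
Qed.

Lemma trig_ext n f g : (forall t, f t = g t) -> trig n f -> trig n g.
Proof. intros H [a [b H']]. exists a, b. intros t. rewrite <- H. apply H'. Qed.

Lemma trig_scal n f c : trig n f -> trig n (fun t => c * f t).
Proof.
  intros H. apply (trig_ext _ (fun t => 0 + c * f t)); [intros; ring|].
  apply (trig_lin n (fun _ => 0)); auto using trig_const.
Qed.

Lemma trig_add n f g : trig n f -> trig n g -> trig n (fun t => f t + g t).
Proof.
  intros Hf Hg. apply (trig_ext _ (fun t => f t + 1 * g t)); [intros; ring|].
  now apply trig_lin.
Qed.

Lemma trig_S n f : trig n f -> trig (S n) f.
Proof.
  intros [a [b H]].
  exists (fun k => if Nat.leb k n then a k else 0), (fun k => if Nat.leb k n then b k else 0).
  intros t. rewrite H. unfold trig_poly. cbn [trig_sum].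
  rewrite (proj2 (Nat.leb_gt (S n) n)) by lia.
  change (Nat.leb 0 n) with true. cbv iota.
  rewrite (trig_sum_ext n a b (fun k => if Nat.leb k n then a k else 0)
             (fun k => if Nat.leb k n then b k else 0)); [ring|].
  intros k Hk. rewrite (proj2 (Nat.leb_le k n)) by lia. auto.
Qed.

Lemma trig_le n m f : (n <= m)%nat -> trig n f -> trig m f.
Proof. induction 1; auto using trig_S. Qed.

Lemma trig_top m A B : trig (S m) (fun t => A * cos (INR (S m) * t) + B * sin (INR (S m) * t)).
Proof.
  exists (fun k => if Nat.eqb k (S m) then A else 0), (fun k => if Nat.eqb k (S m) then B else 0).
  intros t. unfold trig_poly. cbn [trig_sum]. rewrite Nat.eqb_refl.
  rewrite (trig_sum_ext m _ _ (fun _ => 0) (fun _ => 0)).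
  - rewrite trig_sum_0. change (Nat.eqb 0 (S m)) with false. cbv iota. field.
  - intros k Hk. rewrite (proj2 (Nat.eqb_neq k (S m))) by lia. auto.
Qed.

Lemma trig_cos n k : (k <= n)%nat -> trig n (fun t => cos (INR k * t)).
Proof.
  intros Hk. apply (trig_le k); [lia|]. destruct k as [|k].
  - apply (trig_ext _ (fun _ => 1)); [|apply trig_const].
    intros t. simpl. now rewrite Rmult_0_l, cos_0.
  - apply (trig_ext _ (fun t => 1 * cos (INR (S k) * t) + 0 * sin (INR (S k) * t)));
      [intros; ring|apply trig_top].
Qed.

Lemma trig_sin n k : (k <= n)%nat -> trig n (fun t => sin (INR k * t)).
Proof.
  intros Hk. apply (trig_le k); [lia|]. destruct k as [|k].
  - apply (trig_ext _ (fun _ => 0)); [|apply trig_const].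
    intros t. simpl. now rewrite Rmult_0_l, sin_0.
  - apply (trig_ext _ (fun t => 0 * cos (INR (S k) * t) + 1 * sin (INR (S k) * t)));
      [intros; ring|apply trig_top].
Qed.

(** Linearity reduces a property closed under [f + c g] to single harmonics; products, translations,
    periodicity and sampling sums are all treated this way. *)
Lemma trig_elim n (P : (R -> R) -> Prop) :
  (forall f g c, P f -> P g -> P (fun t => f t + c * g t)) ->
  (forall k, (k <= n)%nat -> P (fun t => cos (INR k * t)) /\ P (fun t => sin (INR k * t))) ->
  forall f, trig n f -> P f.
Proof.
  intros Hlin Hb f [a [b H]].
  assert (P0 : P (fun _ => 0)).
  { destruct (Hb O) as [_ H0]; [lia|].
    replace (fun _ : R => 0) with (fun t => sin (INR 0 * t)); [exact H0|].
    extensionality t. simpl. now rewrite Rmult_0_l, sin_0. }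
  replace f with (fun t => trig_sum n a b t + a O / 2 * cos (INR 0 * t)).
  2:{ extensionality t. rewrite H. unfold trig_poly. simpl INR. rewrite Rmult_0_l, cos_0. ring. }
  apply Hlin; [|apply Hb; lia].
  cut (forall k, (k <= n)%nat -> P (trig_sum k a b)); [intros Hk; apply Hk; lia|].
  induction k as [|k IH]; intros Hk; [exact P0|].
  replace (trig_sum (S k) a b) with
    (fun t => (trig_sum k a b t + a (S k) * cos (INR (S k) * t)) + b (S k) * sin (INR (S k) * t)).
  2:{ extensionality t. cbn [trig_sum]. ring. }
  apply Hlin; [apply Hlin; [apply IH; lia|]|]; apply Hb; lia.
Qed.

Lemma trig_mul_cos_sin n f : trig n f ->
  trig (S n) (fun t => cos t * f t) /\ trig (S n) (fun t => sin t * f t).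
Proof.
  revert f. apply trig_elim.
  - intros f g c [Hf1 Hf2] [Hg1 Hg2]. split.
    + apply (trig_ext _ (fun t => cos t * f t + c * (cos t * g t))); [intros; ring|now apply trig_lin].
    + apply (trig_ext _ (fun t => sin t * f t + c * (sin t * g t))); [intros; ring|now apply trig_lin].
  - intros [|k] Hk.
    + assert (C : forall t, cos (INR 0 * t) = 1) by (intros; simpl; now rewrite Rmult_0_l, cos_0).
      assert (S0 : forall t, sin (INR 0 * t) = 0) by (intros; simpl; now rewrite Rmult_0_l, sin_0).
      assert (I1 : forall t, INR 1 * t = t) by (intros; simpl; ring).
      repeat split.
      * apply (trig_ext _ (fun t => cos (INR 1 * t))); [intros; rewrite C, I1; ring|apply trig_cos; lia].
      * apply (trig_ext _ (fun t => sin (INR 1 * t))); [intros; rewrite C, I1; ring|apply trig_sin; lia].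
      * apply (trig_ext _ (fun t => 0)); [intros; rewrite S0; ring|apply trig_const].
      * apply (trig_ext _ (fun t => 0)); [intros; rewrite S0; ring|apply trig_const].
    + assert (U : forall t, INR (S (S k)) * t = INR (S k) * t + t) by (intros; rewrite (S_INR (S k)); ring).
      assert (D : forall t, INR k * t = INR (S k) * t - t) by (intros; rewrite (S_INR k); ring).
      assert (TC1 := trig_cos (S n) (S (S k)) ltac:(lia)).
      assert (TC2 := trig_cos (S n) k ltac:(lia)).
      assert (TS1 := trig_sin (S n) (S (S k)) ltac:(lia)).
      assert (TS2 := trig_sin (S n) k ltac:(lia)).
      repeat split.
      * apply (trig_ext _ (fun t => / 2 * (cos (INR (S (S k)) * t) + 1 * cos (INR k * t)))).
        { intros t. rewrite U, D, cos_plus, cos_minus. field. }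
        apply trig_scal, trig_lin; assumption.
      * apply (trig_ext _ (fun t => / 2 * (sin (INR (S (S k)) * t) + (-1) * sin (INR k * t)))).
        { intros t. rewrite U, D, sin_plus, sin_minus. field. }
        apply trig_scal, trig_lin; assumption.
      * apply (trig_ext _ (fun t => / 2 * (sin (INR (S (S k)) * t) + 1 * sin (INR k * t)))).
        { intros t. rewrite U, D, sin_plus, sin_minus. field. }
        apply trig_scal, trig_lin; assumption.
      * apply (trig_ext _ (fun t => / 2 * (cos (INR k * t) + (-1) * cos (INR (S (S k)) * t)))).
        { intros t. rewrite U, D, cos_plus, cos_minus. field. }
        apply trig_scal, trig_lin; assumption.
Qed.

Lemma trig_mul n k f g : trig n f -> trig k g -> trig (k + n) (fun t => g t * f t).
Proof.
  intros Hf. revert g. apply trig_elim.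
  - intros g h c Hg Hh.
    apply (trig_ext _ (fun t => g t * f t + c * (h t * f t))); [intros; ring|now apply trig_lin].
  - intros j Hj.
    cut (trig (j + n) (fun t => cos (INR j * t) * f t) /\ trig (j + n) (fun t => sin (INR j * t) * f t)).
    { intros [H1 H2]. split; eapply trig_le; try eassumption; lia. }
    clear Hj. induction j as [|j [IH1 IH2]].
    + split.
      * apply (trig_ext _ f); [|exact Hf]. intros t. simpl. rewrite Rmult_0_l, cos_0. ring.
      * apply (trig_ext _ (fun _ => 0)); [|apply trig_const]. intros t. simpl. rewrite Rmult_0_l, sin_0. ring.
    + assert (U : forall t, INR (S j) * t = INR j * t + t) by (intros; rewrite S_INR; ring).
      destruct (trig_mul_cos_sin _ _ IH1) as [A1 A2], (trig_mul_cos_sin _ _ IH2) as [B1 B2].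
      simpl plus. split.
      * apply (trig_ext _ (fun t => cos t * (cos (INR j * t) * f t) + (-1) * (sin t * (sin (INR j * t) * f t)))).
        { intros t. rewrite U, cos_plus. ring. }
        now apply trig_lin.
      * apply (trig_ext _ (fun t => sin t * (cos (INR j * t) * f t) + 1 * (cos t * (sin (INR j * t) * f t)))).
        { intros t. rewrite U, sin_plus. ring. }
        now apply trig_lin.
Qed.

Lemma trig_shift n f s : trig n f -> trig n (fun t => f (t + s)).
Proof.
  revert f. apply (trig_elim n (fun f => trig n (fun t => f (t + s)))).
  - intros f g c Hf Hg. now apply (trig_lin n (fun t => f (t + s)) (fun t => g (t + s))).
  - intros k Hk. split.
    + apply (trig_ext _ (fun t => cos (INR k * s) * cos (INR k * t) + - sin (INR k * s) * sin (INR k * t))).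
      { intros t. rewrite Rmult_plus_distr_l, cos_plus. ring. }
      apply (trig_lin n (fun t => _ * cos (INR k * t))); [apply trig_scal, trig_cos|apply trig_sin]; lia.
    + apply (trig_ext _ (fun t => sin (INR k * s) * cos (INR k * t) + cos (INR k * s) * sin (INR k * t))).
      { intros t. rewrite Rmult_plus_distr_l, sin_plus. ring. }
      apply (trig_lin n (fun t => _ * cos (INR k * t))); [apply trig_scal, trig_cos|apply trig_sin]; lia.
Qed.

Lemma trig_periodic n f t : trig n f -> f (t + 2 * PI) = f t.
Proof.
  revert f. apply (trig_elim n (fun f => f (t + 2 * PI) = f t)).
  - intros f g c -> ->. reflexivity.
  - intros k _.
    replace (INR k * (t + 2 * PI)) with (INR k * t + 2 * INR k * PI) by ring.
    split; [apply cos_period|apply sin_period].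
Qed.

Lemma trig_continuity n f : trig n f -> continuity f.
Proof.
  revert f. apply trig_elim.
  - intros f g c Hf Hg. apply continuity_plus; [exact Hf|].
    apply continuity_mult; [apply continuity_const; now intros x y|exact Hg].
  - intros k _. split; intros t; apply continuity_pt_filterlim.
    + apply (ex_derive_continuous (fun t => cos (INR k * t))). auto_derive. exact I.
    + apply (ex_derive_continuous (fun t => sin (INR k * t))). auto_derive. exact I.
Qed.

(** * Calculus of leading coefficients *)

Lemma lead_trig m A B f : lead m A B f -> trig (S m) f.
Proof.
  intros [g [Hg H]]. apply (trig_ext _ (fun t => (A * cos (INR (S m) * t) + B * sin (INR (S m) * t)) + g t)).
  { intros t. now rewrite H. }
  apply trig_add; [apply trig_top|now apply trig_S].
Qed.

Lemma lead_ext m A B f A' B' g :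
  A = A' -> B = B' -> (forall t, f t = g t) -> lead m A B f -> lead m A' B' g.
Proof. intros <- <- H [h [Hh E]]. exists h. split; [exact Hh|]. intros t. rewrite <- H. apply E. Qed.

Lemma lead_low m A B f g c : lead m A B f -> trig m g -> lead m A B (fun t => f t + c * g t).
Proof.
  intros [h [Hh E]] Hg. exists (fun t => h t + c * g t). split; [now apply trig_lin|].
  intros t. rewrite E. ring.
Qed.

Lemma lead_lin m A B f A' B' g c : lead m A B f -> lead m A' B' g ->
  lead m (A + c * A') (B + c * B') (fun t => f t + c * g t).
Proof.
  intros [h [Hh E]] [h' [Hh' E']]. exists (fun t => h t + c * h' t). split; [now apply trig_lin|].
  intros t. rewrite E, E'. ring.
Qed.

Lemma lead_scal m A B f c : lead m A B f -> lead m (c * A) (c * B) (fun t => c * f t).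
Proof.
  intros [h [Hh E]]. exists (fun t => c * h t). split; [now apply trig_scal|].
  intros t. rewrite E. ring.
Qed.

Lemma lead_shift m A B f s : lead m A B f ->
  lead m (A * cos (INR (S m) * s) + B * sin (INR (S m) * s))
         (B * cos (INR (S m) * s) - A * sin (INR (S m) * s)) (fun t => f (t + s)).
Proof.
  intros [h [Hh E]]. exists (fun t => h (t + s)). split; [now apply trig_shift|].
  intros t. rewrite E, Rmult_plus_distr_l, cos_plus, sin_plus. ring.
Qed.

(** Product-to-sum formulas: [p cos t] sends half of the top harmonic up to order [m + 2] and half
    down to order [m], so the top coefficients are multiplied by [p / 2]. All Chebyshev-type
    recurrences below follow their leading term with this. *)
Lemma lead_mul_cos m A B f p q : lead m A B f ->
  lead (S m) (p * A / 2) (p * B / 2) (fun t => (p * cos t + q) * f t).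
Proof.
  intros Hf. assert (Tf := lead_trig _ _ _ _ Hf). destruct Hf as [h [Hh E]].
  exists (fun t => q * f t + p * (cos t * h t
            + (A / 2 * cos (INR m * t) + B / 2 * sin (INR m * t)))). split.
  - apply trig_lin; [now apply trig_scal|].
    apply trig_add; [now apply trig_mul_cos_sin|].
    apply trig_add; apply trig_scal; [apply trig_cos|apply trig_sin]; lia.
  - intros t. rewrite E.
    replace (INR (S (S m)) * t) with (INR (S m) * t + t) by (rewrite (S_INR (S m)); ring).
    replace (INR m * t) with (INR (S m) * t - t) by (rewrite (S_INR m); ring).
    rewrite cos_plus, sin_plus, cos_minus, sin_minus. field.
Qed.

Lemma in_Fny_lead m y f : in_Fny (S m) y f <-> lead m y 0 f.
Proof.
  unfold in_Fny, lead, trig. replace (S m - 1)%nat with m by lia. split.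
  - intros [a [b H]]. exists (trig_poly m a b). split; [now exists a, b|].
    intros t. rewrite H. ring.
  - intros [g [[a [b Hg]] H]]. exists a, b. intros t. rewrite H, Hg. ring.
Qed.

(** * Sampling the leading harmonic *)

Lemma alternating_sum_cos x th N :
  2 * cos (th / 2) * sum_f_R0 (fun j => (-1) ^ j * cos (x + INR j * th)) N
  = cos (x - th / 2) + (-1) ^ N * cos (x + (INR N + / 2) * th).
Proof.
  induction N as [|N IH].
  - simpl. replace (x + 0 * th) with x by ring. replace ((0 + / 2) * th) with (th / 2) by field.
    rewrite cos_minus, cos_plus. ring.
  - rewrite tech5, Rmult_plus_distr_l, IH.
    replace (x + (INR N + / 2) * th) with ((x + INR (S N) * th) - th / 2) by (rewrite S_INR; field).
    replace (x + (INR (S N) + / 2) * th) with ((x + INR (S N) * th) + th / 2) by (rewrite S_INR; field).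
    rewrite (cos_minus (x + INR (S N) * th)), (cos_plus (x + INR (S N) * th)). simpl pow. ring.
Qed.

Lemma plain_sum_cos x th N :
  2 * sin (th / 2) * sum_f_R0 (fun j => cos (x + INR j * th)) N
  = sin (x + (INR N + / 2) * th) - sin (x - th / 2).
Proof.
  induction N as [|N IH].
  - simpl. replace (x + 0 * th) with x by ring. replace ((0 + / 2) * th) with (th / 2) by field.
    rewrite sin_minus, sin_plus. ring.
  - rewrite tech5, Rmult_plus_distr_l, IH.
    replace (x + (INR N + / 2) * th) with ((x + INR (S N) * th) - th / 2) by (rewrite S_INR; field).
    replace (x + (INR (S N) + / 2) * th) with ((x + INR (S N) * th) + th / 2) by (rewrite S_INR; field).
    rewrite (sin_minus (x + INR (S N) * th)), (sin_plus (x + INR (S N) * th)). ring.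
Qed.

Lemma sum_f_R0_lin F G c N :
  sum_f_R0 (fun j => F j + c * G j) N = sum_f_R0 F N + c * sum_f_R0 G N.
Proof. rewrite sum_plus, scal_sum. f_equal. apply sum_eq. intros. ring. Qed.

Definition node (m j : nat) : R := INR j * (PI / INR (S m)).

Lemma INR_S_pos m : 0 < INR (S m).
Proof. apply lt_0_INR. lia. Qed.

Lemma sin_cos_shift x : sin x = cos (x - PI / 2).
Proof. rewrite cos_minus, cos_PI2, sin_PI2. ring. Qed.

Lemma sin_INR_PI k : sin (INR k * PI) = 0.
Proof. apply sin_eq_0_1. exists (Z.of_nat k). now rewrite INR_IZR_INZ. Qed.

Lemma cos_INR_PI i : cos (INR i * PI) = (-1) ^ i.
Proof.
  induction i as [|i IH]; [simpl; rewrite Rmult_0_l; apply cos_0|].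
  rewrite S_INR, Rmult_plus_distr_r, Rmult_1_l, neg_cos, IH. simpl. ring.
Qed.

Lemma pow_m1_sqr k : (-1) ^ k * (-1) ^ k = 1.
Proof. rewrite <- Rpow_mult_distr. replace (-1 * -1) with 1 by ring. apply pow1. Qed.

(* The nodes alternate exactly like the harmonic of order [m + 1], so all lower harmonics average out. *)
Lemma sample_low m f s : trig m f ->
  sum_f_R0 (fun j => (-1) ^ j * f (s + node m j)) (2 * m + 1) = 0.
Proof.
  revert f. apply (trig_elim m (fun f => sum_f_R0 (fun j => (-1) ^ j * f (s + node m j)) (2 * m + 1) = 0)).
  - intros f g c Hf Hg. rewrite <- (Rplus_0_l 0), <- Hf at 1.
    rewrite <- (Rmult_0_r c), <- Hg, <- sum_f_R0_lin. apply sum_eq. intros. ring.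
  - intros k Hk. assert (Hm := INR_S_pos m).
    assert (Z : forall x, sum_f_R0 (fun j => (-1) ^ j * cos (x + INR j * (INR k * (PI / INR (S m))))) (2 * m + 1) = 0).
    { intros x. set (th := INR k * (PI / INR (S m))).
      assert (Hth : 0 <= th / 2 < PI / 2).
      { unfold th. split.
        - apply Rmult_le_pos; [|lra]. apply Rmult_le_pos; [apply pos_INR|].
          apply Rlt_le, Rdiv_lt_0_compat; [apply PI_RGT_0|exact Hm].
        - apply Rmult_lt_compat_r; [lra|].
          replace (INR k * (PI / INR (S m))) with ((INR k / INR (S m)) * PI) by (field; lra).
          rewrite <- (Rmult_1_l PI) at 2. apply Rmult_lt_compat_r; [apply PI_RGT_0|].
          apply Rlt_div_l; [lra|]. rewrite Rmult_1_l. apply lt_INR. lia. }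
      assert (Hc : 0 < cos (th / 2)) by (apply cos_gt_0; assert (P := PI_RGT_0); lra).
      apply (Rmult_eq_reg_l (2 * cos (th / 2))); [|lra].
      rewrite alternating_sum_cos, Rmult_0_r, Nat.add_1_r, pow_1_odd.
      replace (x + (INR (S (2 * m)) + / 2) * th) with ((x - th / 2) + 2 * INR k * PI).
      2:{ unfold th. rewrite !S_INR, mult_INR. rewrite S_INR in Hm. simpl (INR 2). field. lra. }
      rewrite cos_period. ring. }
    split.
    + rewrite <- (Z (INR k * s)). apply sum_eq. intros j _. unfold node. do 2 f_equal. ring.
    + rewrite <- (Z (INR k * s - PI / 2)). apply sum_eq. intros j _. unfold node.
      rewrite sin_cos_shift. do 2 f_equal. ring.
Qed.

Lemma sample_lead m A B f s : lead m A B f ->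
  sum_f_R0 (fun j => (-1) ^ j * f (s + node m j)) (2 * m + 1)
  = INR (2 * m + 2) * (A * cos (INR (S m) * s) + B * sin (INR (S m) * s)).
Proof.
  intros [g [Hg E]]. assert (Hm := INR_S_pos m).
  rewrite (sum_eq _ (fun j => (A * cos (INR (S m) * s) + B * sin (INR (S m) * s)) + 1 * ((-1) ^ j * g (s + node m j)))).
  2:{ intros j _. rewrite E. unfold node.
      replace (INR (S m) * (s + INR j * (PI / INR (S m)))) with (INR (S m) * s + INR j * PI) by (field; lra).
      rewrite cos_plus, sin_plus, sin_INR_PI, cos_INR_PI.
      replace ((-1) ^ j * (A * (cos (INR (S m) * s) * (-1) ^ j - sin (INR (S m) * s) * 0) +
        B * (sin (INR (S m) * s) * (-1) ^ j + cos (INR (S m) * s) * 0) + g (s + INR j * (PI / INR (S m)))))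
      with (((-1) ^ j * (-1) ^ j) * (A * cos (INR (S m) * s) + B * sin (INR (S m) * s)) + (-1) ^ j * g (s + INR j * (PI / INR (S m)))) by ring.
      rewrite pow_m1_sqr. ring. }
  rewrite sum_f_R0_lin, (sample_low m g s Hg), sum_cte.
  replace (2 * m + 2)%nat with (S (2 * m + 1)) by lia. ring.
Qed.

Lemma Rabs_pow_m1 j x : Rabs ((-1) ^ j * x) = Rabs x.
Proof. rewrite Rabs_mult, pow_1_abs. ring. Qed.

(** The top harmonic at [s] is a mean of [2 m + 2] values of [f] with signs, so it inherits the
    bound. *)
Lemma lead_bound m A B f M s : lead m A B f -> (forall t, Rabs (f t) <= M) ->
  Rabs (A * cos (INR (S m) * s) + B * sin (INR (S m) * s)) <= M.
Proof.
  intros H HM. assert (E := sample_lead m A B f s H).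
  assert (P : 0 < INR (2 * m + 2)) by (apply lt_0_INR; lia).
  apply (Rmult_le_reg_l (INR (2 * m + 2))); [exact P|].
  rewrite <- (Rabs_right (INR (2 * m + 2))) at 1 by lra. rewrite <- Rabs_mult, <- E.
  eapply Rle_trans; [apply Rsum_abs|].
  eapply Rle_trans; [apply (sum_Rle _ (fun _ => M))|].
  - intros j _. rewrite Rabs_pow_m1. apply HM.
  - rewrite sum_cte. replace (2 * m + 2)%nat with (S (2 * m + 1)) by lia. lra.
Qed.

Lemma angle_of_unit p q : p * p + q * q = 1 -> exists x, cos x = p /\ sin x = q.
Proof.
  intros H.
  assert (Hp : -1 <= p <= 1) by nra.
  assert (Hs : sin (acos p) = sqrt (q * q)).
  { rewrite sin_acos by exact Hp. f_equal. unfold Rsqr. lra. }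
  destruct (Rle_dec 0 q) as [Hq|Hq].
  - exists (acos p). rewrite cos_acos, Hs by exact Hp. split; [reflexivity|]. now apply sqrt_square.
  - exists (- acos p). rewrite cos_neg, sin_neg, cos_acos, Hs by exact Hp. split; [reflexivity|].
    replace (q * q) with (-q * -q) by ring. rewrite sqrt_square; lra.
Qed.

(** This is [lead_bound] at a point where the harmonic reaches its amplitude. *)
Lemma lead_amplitude m A B f M : lead m A B f -> (forall t, Rabs (f t) <= M) ->
  A * A + B * B <= M * M.
Proof.
  intros H HM.
  assert (M0 : 0 <= M) by (eapply Rle_trans; [apply Rabs_pos|apply (HM 0)]).
  destruct (Req_dec (A * A + B * B) 0) as [Z|NZ]; [nra|].
  set (r := sqrt (A * A + B * B)).
  assert (Rr : r * r = A * A + B * B) by (apply sqrt_sqrt; nra).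
  assert (r0 : 0 < r) by (apply sqrt_lt_R0; nra).
  destruct (angle_of_unit (A / r) (B / r)) as [x [Hc Hs]].
  { replace (A / r * (A / r) + B / r * (B / r)) with ((A * A + B * B) / (r * r)) by (field; lra).
    rewrite Rr. field. exact NZ. }
  assert (E := lead_bound m A B f M (x / INR (S m)) H HM).
  replace (INR (S m) * (x / INR (S m))) with x in E by (field; apply Rgt_not_eq, INR_S_pos).
  rewrite Hc, Hs in E.
  replace (A * (A / r) + B * (B / r)) with ((A * A + B * B) / r) in E by (field; lra).
  rewrite <- Rr in E. replace (r * r / r) with r in E by (field; lra).
  rewrite Rabs_right in E by lra. rewrite <- Rr. nra.
Qed.

(** The top harmonic is bounded by [M], so removing it at most doubles the bound. The constant is
    crude; what matters is that it does not depend on the polynomial. *)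
Lemma coef_bound m : forall a b M, (forall t, Rabs (trig_poly m a b t) <= M) ->
  forall k, (1 <= k <= m)%nat -> Rabs (a k) <= 2 ^ m * M /\ Rabs (b k) <= 2 ^ m * M.
Proof.
  induction m as [|m IH]; intros a b M HM k Hk; [lia|].
  assert (M0 : 0 <= M) by (eapply Rle_trans; [apply Rabs_pos|apply (HM 0)]).
  assert (L : lead m (a (S m)) (b (S m)) (trig_poly (S m) a b)).
  { exists (trig_poly m a b). split; [now exists a, b|]. intros t. unfold trig_poly. cbn [trig_sum]. ring. }
  assert (P : 1 <= 2 ^ m) by (apply pow_R1_Rle; lra).
  destruct (Nat.eq_dec k (S m)) as [->|Hne].
  - assert (Q := lead_amplitude _ _ _ _ _ L HM). simpl pow.
    assert (M <= 2 * 2 ^ m * M) by nra.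
    assert (forall x, x * x <= M * M -> Rabs x <= M) by (intros x Hx; apply Rabs_le; split; nra).
    split; (eapply Rle_trans; [|eassumption]); apply H0; nra.
  - assert (HM' : forall t, Rabs (trig_poly m a b t) <= 2 * M).
    { intros t. assert (E1 := HM t). assert (E2 := lead_bound _ _ _ _ _ t L HM).
      replace (trig_poly m a b t) with (trig_poly (S m) a b t + - (a (S m) * cos (INR (S m) * t) + b (S m) * sin (INR (S m) * t)))
        by (unfold trig_poly; cbn [trig_sum]; ring).
      eapply Rle_trans; [apply Rabs_triang|]. rewrite Rabs_Ropp. lra. }
    destruct (IH a b (2 * M) HM' k) as [E1 E2]; [lia|].
    simpl pow. split; nra.
Qed.

(** The mean over [2 m + 2] equispaced nodes annihilates all harmonics of orders 1 to [2 m]. The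
    order [2 m] is what squares of polynomials of order [m] require. *)
Lemma average_indep m f s s' : trig (2 * m) f ->
  sum_f_R0 (fun j => f (s + node m j)) (2 * m + 1) = sum_f_R0 (fun j => f (s' + node m j)) (2 * m + 1).
Proof.
  revert f. apply (trig_elim (2 * m) (fun f =>
    sum_f_R0 (fun j => f (s + node m j)) (2 * m + 1) = sum_f_R0 (fun j => f (s' + node m j)) (2 * m + 1))).
  - intros f g c Hf Hg. now rewrite !sum_f_R0_lin, Hf, Hg.
  - intros k Hk. assert (Hm := INR_S_pos m).
    assert (Z : forall x x', sum_f_R0 (fun j => cos (x + INR j * (INR k * (PI / INR (S m))))) (2 * m + 1)
      = sum_f_R0 (fun j => cos (x' + INR j * (INR k * (PI / INR (S m))))) (2 * m + 1) \/ k = O).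
    { intros x x'. destruct k as [|k]; [now right|left]. set (th := INR (S k) * (PI / INR (S m))).
      assert (Hth : 0 < th / 2 < PI).
      { unfold th. assert (Hk0 := INR_S_pos k). assert (P := PI_RGT_0). split.
        - apply Rdiv_lt_0_compat; [|lra]. apply Rmult_lt_0_compat; [exact Hk0|].
          now apply Rdiv_lt_0_compat.
        - replace (INR (S k) * (PI / INR (S m)) / 2) with ((INR (S k) / (2 * INR (S m))) * PI) by (field; lra).
          rewrite <- (Rmult_1_l PI) at 2. apply Rmult_lt_compat_r; [lra|].
          apply Rlt_div_l; [lra|]. rewrite Rmult_1_l. replace 2 with (INR 2) by reflexivity.
          rewrite <- mult_INR. apply lt_INR. lia. }
      assert (Hc : 0 < sin (th / 2)) by (apply sin_gt_0; lra).
      assert (W : forall x, sum_f_R0 (fun j => cos (x + INR j * th)) (2 * m + 1) = 0).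
      { intros z. apply (Rmult_eq_reg_l (2 * sin (th / 2))); [|lra].
        rewrite plain_sum_cos, Rmult_0_r.
        replace (z + (INR (2 * m + 1) + / 2) * th) with ((z - th / 2) + 2 * INR (S k) * PI).
        2:{ unfold th. rewrite plus_INR, mult_INR, (S_INR m). rewrite S_INR in Hm. simpl (INR 2); simpl (INR 1). field. lra. }
        rewrite sin_period. ring. }
      now rewrite !W. }
    assert (E : forall z j, INR k * (z + node m j) = INR k * z + INR j * (INR k * (PI / INR (S m)))) by (intros; unfold node; ring).
    split.
    + destruct (Z (INR k * s) (INR k * s')) as [H|H].
      * rewrite (sum_eq _ _ _ (fun j _ => f_equal cos (E s j))), H. apply sum_eq. intros. now rewrite E.
      * subst k. apply sum_eq. intros. simpl. now rewrite !Rmult_0_l.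
    + destruct (Z (INR k * s - PI / 2) (INR k * s' - PI / 2)) as [H|H].
      * transitivity (sum_f_R0 (fun j => cos (INR k * s - PI / 2 + INR j * (INR k * (PI / INR (S m))))) (2 * m + 1)).
        { apply sum_eq. intros. rewrite sin_cos_shift, E. f_equal. ring. }
        rewrite H. apply sum_eq. intros. rewrite sin_cos_shift, E. f_equal. ring.
      * subst k. apply sum_eq. intros. simpl. now rewrite !Rmult_0_l.
Qed.

Lemma sum_nonneg F N : (forall j, (j <= N)%nat -> 0 <= F j) -> 0 <= sum_f_R0 F N.
Proof.
  induction N as [|N IH]; intros H; simpl; [apply H; lia|].
  apply Rplus_le_le_0_compat; [apply IH; intros; apply H; lia|apply H; lia].
Qed.

Lemma sum_nonneg_zero F N : (forall j, (j <= N)%nat -> 0 <= F j) -> sum_f_R0 F N = 0 ->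
  forall j, (j <= N)%nat -> F j = 0.
Proof.
  induction N as [|N IH]; intros HF H j Hj; simpl in H.
  - now replace j with O by lia.
  - assert (P : 0 <= sum_f_R0 F N) by (apply sum_nonneg; intros; apply HF; lia).
    assert (Q : 0 <= F (S N)) by (apply HF; lia).
    destruct (Nat.eq_dec j (S N)) as [->|Hne]; [lra|].
    apply IH; [intros; apply HF; lia|lra|lia].
Qed.

(** The nodal mean of [f^2] is zero and survives translation of the nodes, so a sum of squares
    containing [f t ^ 2] vanishes. *)
Lemma trig_zero_at_nodes m f : trig m f -> (forall j, (j <= 2 * m + 1)%nat -> f (node m j) = 0) ->
  forall t, f t = 0.
Proof.
  intros Hf Z t.
  assert (T2 : trig (2 * m) (fun t => f t * f t)).
  { replace (2 * m)%nat with (m + m)%nat by lia. now apply trig_mul. }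
  assert (E := average_indep m _ t 0 T2). cbv beta in E.
  rewrite (sum_eq (fun j => f (0 + node m j) * f (0 + node m j)) (fun _ => 0)) in E.
  2:{ intros j Hj. rewrite Rplus_0_l, Z by exact Hj. ring. }
  rewrite sum_cte, Rmult_0_l in E.
  assert (Q := sum_nonneg_zero _ _ (fun j _ => Rle_0_sqr (f (t + node m j))) E O ltac:(lia)).
  cbv beta in Q. unfold node in Q. simpl INR in Q. rewrite Rmult_0_l, Rplus_0_r in Q.
  now apply Rsqr_0_uniq.
Qed.

(* Equality in the sampling bound forces [F] to take the values [eps * (-1)^j] at all nodes. *)
Lemma lead_extremal m eps F : eps * eps = 1 -> lead m eps 0 F -> (forall t, Rabs (F t) <= 1) ->
  forall t, F t = eps * cos (INR (S m) * t).
Proof.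
  intros He HF HM t.
  assert (E := sample_lead m eps 0 F 0 HF).
  rewrite Rmult_0_r, cos_0, sin_0 in E.
  assert (Ea : Rabs eps = 1).
  { apply Rsqr_inj; [apply Rabs_pos|lra|]. rewrite <- Rsqr_abs. unfold Rsqr. lra. }
  assert (V : forall j, (j <= 2 * m + 1)%nat -> 1 - eps * ((-1) ^ j * F (node m j)) = 0).
  { apply (sum_nonneg_zero (fun j => 1 - eps * ((-1) ^ j * F (node m j)))).
    - intros j _. cut (eps * ((-1) ^ j * F (node m j)) <= 1); [lra|].
      eapply Rle_trans; [apply Rle_abs|]. rewrite Rabs_mult, Rabs_pow_m1, Ea, Rmult_1_l. apply HM.
    - rewrite (sum_eq _ (fun j => 1 + (- eps) * ((-1) ^ j * F (0 + node m j)))) by (intros; rewrite Rplus_0_l; ring).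
      rewrite sum_f_R0_lin, E, sum_cte.
      replace (2 * m + 2)%nat with (S (2 * m + 1)) by lia.
      replace (1 * INR (S (2 * m + 1)) + - eps * (INR (S (2 * m + 1)) * (eps * 1 + 0 * 0)))
        with (INR (S (2 * m + 1)) * (1 - eps * eps)) by ring. rewrite He. ring. }
  destruct HF as [g [Hg Eg]].
  assert (G0 : forall t, g t = 0).
  { apply (trig_zero_at_nodes m); [exact Hg|]. intros j Hj.
    assert (Q := V j Hj). rewrite Eg in Q.
    replace (INR (S m) * node m j) with (INR j * PI) in Q by (unfold node; field; apply Rgt_not_eq, INR_S_pos).
    rewrite cos_INR_PI in Q.
    assert (Q1 := pow_m1_sqr j).
    assert (Q2 : (eps * eps) * ((-1) ^ j * (-1) ^ j) = 1) by (rewrite He, Q1; ring).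
    assert (Q3 : eps * (-1) ^ j * g (node m j) = 0) by nra.
    apply Rmult_integral in Q3. destruct Q3 as [Q3|Q3]; [|exact Q3]. nra. }
  rewrite Eg, G0. ring.
Qed.

(** * The contraction *)

Lemma two_step_ind (P : nat -> Prop) :
  P 0%nat -> P 1%nat -> (forall k, P k -> P (S k) -> P (S (S k))) -> forall k, P k.
Proof.
  intros H0 H1 H2 k. cut (P k /\ P (S k)); [tauto|].
  induction k as [|k [A B]]; auto.
Qed.

Lemma cheb_cos k x : cheb k (cos x) = cos (INR k * x).
Proof.
  induction k as [| |k A B] using two_step_ind.
  - simpl. now rewrite Rmult_0_l, cos_0.
  - simpl. now rewrite Rmult_1_l.
  - change (cheb (S (S k)) (cos x)) with (2 * cos x * cheb (S k) (cos x) - cheb k (cos x)).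
    rewrite A, B. replace (INR (S (S k)) * x) with (INR (S k) * x + x) by (rewrite (S_INR (S k)); ring).
    replace (INR k * x) with (INR (S k) * x - x) by (rewrite (S_INR k); ring).
    rewrite cos_plus, cos_minus. ring.
Qed.

(** Each recurrence step multiplies the top coefficient by [2 Y / 2]. With [Y = q^2] the function is
    a cosine of a multiple of [tau], with [Y = 1 / q^2] an extremal polynomial. *)
Lemma cheb_lead Y k : lead k (Y ^ S k) 0 (fun t => cheb (S k) (Y * cos t + (1 - Y))).
Proof.
  induction k as [| |k A B] using two_step_ind.
  - exists (fun _ => 1 - Y). split; [apply trig_const|]. intros t. simpl. rewrite Rmult_1_l. ring.
  (* Order two is separate: its recurrence reaches down to the constant [cheb 0], to which the claim
     does not apply. *)
  - assert (L : lead 0 Y 0 (fun t => Y * cos t + (1 - Y))).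
    { exists (fun _ => 1 - Y). split; [apply trig_const|]. intros t. simpl. rewrite Rmult_1_l. ring. }
    apply (lead_mul_cos _ _ _ _ (2 * Y) (2 * (1 - Y))) in L.
    apply (lead_low _ _ _ _ _ (-1)) with (2 := trig_const 1 1) in L.
    revert L. apply lead_ext; [field|field|]. intros t. simpl. ring.
  - apply (lead_mul_cos _ _ _ _ (2 * Y) (2 * (1 - Y))) in B.
    apply lead_trig, trig_S in A.
    apply (lead_low _ _ _ _ _ (-1)) with (2 := A) in B.
    revert B. apply lead_ext; [simpl; field|field|]. intros t.
    change (cheb (S (S (S k))) (Y * cos t + (1 - Y))) with
      (2 * (Y * cos t + (1 - Y)) * cheb (S (S k)) (Y * cos t + (1 - Y)) - cheb (S k) (Y * cos t + (1 - Y))).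
    ring.
Qed.

(** Chebyshev polynomials of the second kind, shifted: [chebU k] is U_(k-1), so [k] is the order of
    the sine that it represents. *)
Fixpoint chebU (n : nat) (x : R) : R :=
  match n with
  | O => 0
  | S m => match m with
           | O => 1
           | S p => 2 * x * chebU m x - chebU p x
           end
  end.

Lemma chebU_sin k x : sin x * chebU k (cos x) = sin (INR k * x).
Proof.
  induction k as [| |k A B] using two_step_ind.
  - simpl. rewrite Rmult_0_l, sin_0. ring.
  - simpl. rewrite Rmult_1_l. ring.
  - change (chebU (S (S k)) (cos x)) with (2 * cos x * chebU (S k) (cos x) - chebU k (cos x)).
    replace (sin x * (2 * cos x * chebU (S k) (cos x) - chebU k (cos x)))
      with (2 * cos x * (sin x * chebU (S k) (cos x)) - sin x * chebU k (cos x)) by ring.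
    rewrite A, B. replace (INR (S (S k)) * x) with (INR (S k) * x + x) by (rewrite (S_INR (S k)); ring).
    replace (INR k * x) with (INR (S k) * x - x) by (rewrite (S_INR k); ring).
    rewrite sin_plus, sin_minus. ring.
Qed.

Lemma chebU_lead q k :
  lead k 0 (q * (q * q) ^ k) (fun t => q * sin t * chebU (S k) (q * q * cos t + (1 - q * q))).
Proof.
  assert (L : lead 0 0 q (fun t => q * sin t)).
  { exists (fun _ => 0). split; [apply trig_const|]. intros t. simpl. rewrite Rmult_1_l. ring. }
  induction k as [| |k A B] using two_step_ind.
  - revert L. apply lead_ext; [reflexivity|simpl; ring|]. intros t. simpl. ring.
  - apply (lead_mul_cos _ _ _ _ (2 * (q * q)) (2 * (1 - q * q))) in L.
    revert L. apply lead_ext; [field|simpl; field|]. intros t. simpl. ring.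
  - apply (lead_mul_cos _ _ _ _ (2 * (q * q)) (2 * (1 - q * q))) in B.
    apply lead_trig, trig_S in A.
    apply (lead_low _ _ _ _ _ (-1)) with (2 := A) in B.
    revert B. apply lead_ext; [field|simpl; field|]. intros t.
    change (chebU (S (S (S k))) (q * q * cos t + (1 - q * q))) with
      (2 * (q * q * cos t + (1 - q * q)) * chebU (S (S k)) (q * q * cos t + (1 - q * q))
       - chebU (S k) (q * q * cos t + (1 - q * q))).
    ring.
Qed.

(** The value of [chebU k] at -1, that is, the limit of sin (k x) / sin x at pi. *)
Definition chebU_at_m1 (k : nat) : R := - INR k * (-1) ^ k.

(** The quotient of [chebU k x - chebU k (-1)] by [1 + x], given by its own recurrence so that
    bounds and leading terms follow by induction without a division. *)
Fixpoint chebR (n : nat) (x : R) : R :=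
  match n with
  | O => 0
  | S m => match m with
           | O => 0
           | S p => 2 * x * chebR m x - chebR p x + 2 * chebU_at_m1 m
           end
  end.

Lemma chebR_SS k x : chebR (S (S k)) x = 2 * x * chebR (S k) x - chebR k x + 2 * chebU_at_m1 (S k).
Proof. reflexivity. Qed.

Lemma chebR_chebU k x : (1 + x) * chebR k x = chebU k x - chebU_at_m1 k.
Proof.
  induction k as [| |k A B] using two_step_ind.
  - unfold chebU_at_m1. simpl. ring.
  - unfold chebU_at_m1. simpl. ring.
  - rewrite chebR_SS.
    change (chebU (S (S k)) x) with (2 * x * chebU (S k) x - chebU k x).
    replace ((1 + x) * (2 * x * chebR (S k) x - chebR k x + 2 * chebU_at_m1 (S k)))
      with (2 * x * ((1 + x) * chebR (S k) x) - (1 + x) * chebR k x + 2 * (1 + x) * chebU_at_m1 (S k)) by ring.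
    rewrite A, B. unfold chebU_at_m1. rewrite !S_INR. simpl pow. ring.
Qed.

(** Subtracting the right multiple of sin x yields the extra factor 1 + cos x; at [tau] this turns
    cos (tau/2) into its cube. *)
Lemma chebR_sin k x :
  sin (INR k * x) - chebU_at_m1 k * sin x = sin x * (1 + cos x) * chebR k (cos x).
Proof.
  replace (sin x * (1 + cos x) * chebR k (cos x)) with (sin x * ((1 + cos x) * chebR k (cos x))) by ring.
  rewrite chebR_chebU, <- chebU_sin. ring.
Qed.

Lemma chebR_bound k : exists C, 0 <= C /\ forall x, -1 <= x <= 1 -> Rabs (chebR k x) <= C.
Proof.
  induction k as [| |k [C [HC A]] [D [HD B]]] using two_step_ind.
  - exists 0. split; [lra|]. intros. simpl. rewrite Rabs_R0. lra.
  - exists 0. split; [lra|]. intros. simpl. rewrite Rabs_R0. lra.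
  - exists (2 * D + C + 2 * Rabs (chebU_at_m1 (S k))).
    assert (P := Rabs_pos (chebU_at_m1 (S k))). split; [lra|]. intros x Hx. rewrite chebR_SS.
    specialize (A x Hx). specialize (B x Hx).
    assert (Ax : Rabs x <= 1) by (apply Rabs_le; lra).
    unfold Rminus. eapply Rle_trans; [apply Rabs_triang|].
    rewrite (Rabs_mult 2 (chebU_at_m1 (S k))), (Rabs_right 2) by lra.
    apply Rplus_le_compat_r. eapply Rle_trans; [apply Rabs_triang|]. rewrite Rabs_Ropp.
    apply Rplus_le_compat; [|exact A]. rewrite !Rabs_mult, (Rabs_right 2) by lra.
    assert (Q := Rabs_pos x). assert (Q' := Rabs_pos (chebR (S k) x)). nra.
Qed.

(** The substitute for sin tau (1 + cos tau): it equals 4 q s c (c^2 + (1 - q^3) s^2) with s, c the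
    sine and cosine of t/2. *)
Definition oddW (q t : R) : R := q * sin t * (2 - q ^ 3 + q ^ 3 * cos t).

Lemma oddW_lead q : lead 1 0 (q ^ 4 / 2) (oddW q).
Proof.
  assert (L : lead 0 0 q (fun t => q * sin t)).
  { exists (fun _ => 0). split; [apply trig_const|]. intros t. simpl. rewrite Rmult_1_l. ring. }
  apply (lead_mul_cos _ _ _ _ (q ^ 3) (2 - q ^ 3)) in L.
  revert L. apply lead_ext; [field|simpl; field|]. intros t. unfold oddW. ring.
Qed.

(** [oddW] starts with [q^4 / 2] at order two, the constant [chebR 2 = 2] makes this [q^4], and each
    further order contributes [q^2]: the sines scale like the cosines. Order one is absent since
    [chebR 1 = 0]. *)
Lemma chebR_lead q k : lead (S k) 0 ((q * q) ^ S (S k))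
  (fun t => oddW q t * chebR (S (S k)) (q * q * cos t + (1 - q * q))).
Proof.
  assert (L2 : lead 1 0 ((q * q) ^ 2) (fun t => oddW q t * chebR 2 (q * q * cos t + (1 - q * q)))).
  { assert (L := lead_scal _ _ _ _ 2 (oddW_lead q)). revert L.
    apply lead_ext; [ring|simpl; field|]. intros t. simpl. unfold chebU_at_m1. simpl. ring. }
  assert (T : forall j, trig (S (S j)) (oddW q)).
  { intros j. apply (trig_le 2); [lia|]. eapply lead_trig, oddW_lead. }
  induction k as [| |k A B] using two_step_ind.
  - exact L2.
  - apply (lead_mul_cos _ _ _ _ (2 * (q * q)) (2 * (1 - q * q))) in L2.
    apply (lead_low _ _ _ _ _ (2 * chebU_at_m1 2)) with (2 := T 0%nat) in L2.
    revert L2. apply lead_ext; [field|simpl; field|]. intros t.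
    rewrite (chebR_SS 1). change (chebR 1 (q * q * cos t + (1 - q * q))) with 0. ring.
  - apply (lead_mul_cos _ _ _ _ (2 * (q * q)) (2 * (1 - q * q))) in B.
    apply lead_trig, trig_S in A.
    apply (lead_low _ _ _ _ _ (-1)) with (2 := A) in B.
    apply (lead_low _ _ _ _ _ (2 * chebU_at_m1 (S (S (S k))))) with (2 := T (S k)) in B.
    revert B. apply lead_ext; [field|simpl; field|]. intros t.
    rewrite (chebR_SS (S (S k))). ring.
Qed.

(** Fixed coefficients on arbitrary families in place of the cosines and sines, so that a polynomial
    and its transforms can be compared term by term. *)
Fixpoint comb (n : nat) (a b : nat -> R) (C D : nat -> R -> R) (t : R) : R :=
  match n with
  | O => 0
  | S m => comb m a b C D t + (a (S m) * C (S m) t + b (S m) * D (S m) t)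
  end.

Lemma comb_lead a b C D al be m :
  (forall k, lead k (al k) 0 (C (S k))) -> (forall k, lead k 0 (be k) (D (S k))) ->
  lead m (al m * a (S m)) (be m * b (S m)) (fun t => a O / 2 + comb (S m) a b C D t).
Proof.
  intros HC HD.
  assert (T : forall n, trig n (comb n a b C D)).
  { induction n as [|n IH]; [apply (trig_const 0 0)|].
    apply (trig_ext _ (fun t => comb n a b C D t + (a (S n) * C (S n) t + b (S n) * D (S n) t))); [reflexivity|].
    apply trig_add; [now apply trig_S|].
    apply trig_add; apply trig_scal; eapply lead_trig; eauto. }
  assert (L := lead_lin _ _ _ _ _ _ _ (b (S m)) (lead_scal _ _ _ _ (a (S m)) (HC m)) (HD m)).
  apply (lead_low _ _ _ _ _ 1) with (2 := T m) in L.
  apply (lead_low _ _ _ _ _ (a O / 2)) with (2 := trig_const m 1) in L.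
  revert L. apply lead_ext; [ring|ring|]. intros t. cbn [comb]. ring.
Qed.

(** Not periodic: [tau q (t + 2 * PI) = - tau q t]. Comparisons of a polynomial with values at [tau]
    are therefore made on [-pi, pi] and extended by periodicity of the polynomial. *)
Definition tau (q t : R) : R := 2 * asin (q * sin (t / 2)).

Lemma half_range t : - PI <= t <= PI -> 0 <= cos (t / 2).
Proof. intros H. apply cos_ge_0; lra. Qed.

Lemma sin_cos_half t : sin (t / 2) * sin (t / 2) + cos (t / 2) * cos (t / 2) = 1.
Proof. apply sin2_cos2. Qed.

Lemma sin_double_half t : sin t = 2 * sin (t / 2) * cos (t / 2).
Proof. replace t with (2 * (t / 2)) at 1 by field. apply sin_2a. Qed.

Lemma cos_double_half t : cos t = 1 - 2 * sin (t / 2) * sin (t / 2).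
Proof. replace t with (2 * (t / 2)) at 1 by field. apply cos_2a_sin. Qed.

Section Tau.
Variable q : R.
Hypothesis Hq : 0 < q <= 1.

Lemma tau_arg t : -1 <= q * sin (t / 2) <= 1.
Proof. assert (S := SIN_bound (t / 2)). nra. Qed.

Lemma sin_half_tau t : sin (tau q t / 2) = q * sin (t / 2).
Proof.
  unfold tau. replace (2 * asin (q * sin (t / 2)) / 2) with (asin (q * sin (t / 2))) by field.
  apply sin_asin, tau_arg.
Qed.

Lemma tau_range t : - PI <= tau q t <= PI.
Proof.
  unfold tau. assert (H := asin_bound (q * sin (t / 2))). lra.
Qed.

Lemma cos_half_tau_pos t : 0 <= cos (tau q t / 2).
Proof. apply half_range, tau_range. Qed.

Lemma cos_tau t : cos (tau q t) = q * q * cos t + (1 - q * q).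
Proof. rewrite (cos_double_half (tau q t)), sin_half_tau, (cos_double_half t). ring. Qed.

Lemma cos_half_tau_sqr t : cos (tau q t / 2) * cos (tau q t / 2)
  = cos (t / 2) * cos (t / 2) + (1 - q * q) * (sin (t / 2) * sin (t / 2)).
Proof.
  assert (H := sin_cos_half (tau q t)). rewrite sin_half_tau in H.
  assert (H' := sin_cos_half t). nra.
Qed.
End Tau.

(* Replacing [cos^3] of the contracted half angle by [c (c^2 + (1 - q^3) s^2)] makes the odd part a
   trigonometric polynomial again; the coefficient [1 - q^3] makes its leading coefficient scale
   by exactly the same power of [q] as that of the even part. *)
Lemma cube_error q d c s z : 0 < q -> 0 < d -> q * q + d * d = 1 -> 0 <= c -> 0 <= z ->
  s * s + c * c = 1 -> z * z = c * c + d * d * (s * s) ->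
  Rabs (z ^ 3 - c * (c * c + (1 - q ^ 3) * (s * s))) <= 5 / 2 * d ^ 3.
Proof.
  intros Hq Hd Hqd Hc Hz Hsc Hzz.
  assert (d1 : d <= 1) by nra. assert (q1 : q <= 1) by nra.
  assert (s2 : 0 <= s * s <= 1) by nra. assert (c1 : c <= 1) by nra.
  set (h := z - c). assert (h0 : 0 <= h) by (unfold h; nra).
  assert (hh : d * d * (s * s) = h * (2 * c + h)) by (unfold h; nra).
  assert (hd : h <= d).
  { apply Rsqr_incr_0_var; [|lra]. unfold Rsqr. nra. }
  (* To first order z^3 is c^3 + (3/2) c d^2 s^2, and 1 - q^3 differs from (3/2) d^2 by (1 - q)^2
     (1/2 + q), which has a double zero at q = 1. *)
  assert (E : z ^ 3 - c * (c * c + (1 - q ^ 3) * (s * s))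
    = h * h * (3 / 2 * c + h) + (c * (s * s)) * ((1 - q) * (1 - q) * (/ 2 + q))).
  { replace z with (c + h) by (unfold h; ring).
    replace ((1 - q) * (1 - q) * (/ 2 + q)) with (3 / 2 * (1 - q * q) - (1 - q ^ 3)) by field.
    replace (1 - q * q) with (d * d) by lra.
    replace (c * (s * s) * (3 / 2 * (d * d) - (1 - q ^ 3)))
      with (3 / 2 * c * (d * d * (s * s)) - c * ((1 - q ^ 3) * (s * s))) by field.
    rewrite hh. field. }
  rewrite E.
  assert (B1 : 0 <= h * h * (3 / 2 * c + h) <= d ^ 3).
  { split; [apply Rmult_le_pos; nra|].
    apply Rle_trans with (h * (d * d * (s * s))).
    - rewrite hh. nra.
    - simpl. rewrite Rmult_1_r. apply Rmult_le_compat; nra. }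
  assert (B2 : 0 <= (1 - q) * (1 - q) * (/ 2 + q) <= 3 / 2 * d ^ 3).
  { assert (e : 0 <= 1 - q <= d * d) by nra.
    assert (e2 : (1 - q) * (1 - q) <= d ^ 3).
    { apply Rle_trans with (d * d * (d * d)); [apply Rmult_le_compat; lra|].
      assert (0 < d * d) by nra. simpl. nra. }
    split; [apply Rmult_le_pos; nra|].
    assert (0 < d ^ 3) by (apply pow_lt; lra). assert (0 <= (1 - q) * (1 - q)) by nra. nra. }
  assert (cs : 0 <= c * (s * s) <= 1) by nra.
  rewrite Rabs_right; [|nra]. nra.
Qed.

Definition contraction (q : R) (n : nat) (a b : nat -> R) (t : R) : R :=
  a O / 2 + comb n a b (fun k t => cheb k (q * q * cos t + (1 - q * q)))
                       (fun k t => oddW q t * chebR k (q * q * cos t + (1 - q * q))) t.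

(** The total multiple of sin t subtracted from the sine terms. It is minus the derivative at pi,
    hence zero at a critical point. *)
Fixpoint slope (n : nat) (b : nat -> R) : R :=
  match n with O => 0 | S m => slope m b + b (S m) * chebU_at_m1 (S m) end.

Lemma trig_sum_deriv n a b t : derivable_pt_lim (trig_sum n a b) t
  (trig_sum n (fun k => INR k * b k) (fun k => - (INR k * a k)) t).
Proof.
  induction n as [|n IH]; [apply derivable_pt_lim_const|]. cbn [trig_sum].
  apply is_derive_Reals in IH. apply is_derive_Reals.
  apply (is_derive_plus (trig_sum n a b)
    (fun t => a (S n) * cos (INR (S n) * t) + b (S n) * sin (INR (S n) * t))); [exact IH|].
  auto_derive; [exact I|]. change (match n with O => 1 | S _ => INR n + 1 end) with (INR (S n)). ring.
Qed.

Lemma slope_eq n a b :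
  trig_sum n (fun k => INR k * b k) (fun k => - (INR k * a k)) PI = - slope n b.
Proof.
  induction n as [|n IH]; [simpl; ring|]. cbn [trig_sum slope].
  rewrite IH, sin_INR_PI, cos_INR_PI. unfold chebU_at_m1. ring.
Qed.

Lemma slope_zero n a b : derivable_pt_lim (trig_poly n a b) PI 0 -> slope n b = 0.
Proof.
  intros H.
  assert (E : derivable_pt_lim (trig_poly n a b) PI (0 + - slope n b)).
  { apply (derivable_pt_lim_plus (fun _ => a O / 2) (trig_sum n a b)); [apply derivable_pt_lim_const|].
    rewrite <- (slope_eq n a b). apply trig_sum_deriv. }
  assert (Q := uniqueness_limite _ _ _ _ H E). lra.
Qed.

Lemma trig_sum_slope n a b t : trig_sum n a b t
  = comb n a b (fun k t => cos (INR k * t)) (fun k t => sin (INR k * t) - chebU_at_m1 k * sin t) t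
    + slope n b * sin t.
Proof. induction n as [|n IH]; [simpl; ring|]. cbn [trig_sum comb slope]. rewrite IH. ring. Qed.

(** The cosine terms agree exactly, which is why only [b] is bounded. An odd term errs by at most 4
    times the cube error 5/2 d^3 times the bound [D] of [chebR]; hence [10 * D]. *)
Lemma contraction_error n : exists C, 0 <= C /\ forall q d a b K t,
  0 < q -> 0 < d -> q * q + d * d = 1 -> 0 <= K -> - PI <= t <= PI ->
  (forall k, (1 <= k <= n)%nat -> Rabs (b k) <= K) ->
  Rabs (comb n a b (fun k t => cheb k (q * q * cos t + (1 - q * q)))
              (fun k t => oddW q t * chebR k (q * q * cos t + (1 - q * q))) t
        - comb n a b (fun k t => cos (INR k * t)) (fun k t => sin (INR k * t) - chebU_at_m1 k * sin t) (tau q t))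
  <= C * K * d ^ 3.
Proof.
  induction n as [|n [C [HC IH]]].
  - exists 0. split; [lra|]. intros. simpl comb. rewrite Rminus_0_r, Rabs_R0. lra.
  - destruct (chebR_bound (S n)) as [D [HD HR]].
    exists (C + 10 * D). split; [lra|]. intros q d a b K t Hq Hd Hqd HK Ht Hb.
    assert (Hq1 : 0 < q <= 1) by nra.
    cbn [comb]. rewrite <- (cos_tau q Hq1), cheb_cos, chebR_sin.
    match goal with |- Rabs (?u + (?v + ?x * ?y) - (?u' + (?v + ?x * ?y'))) <= _ =>
      replace (u + (v + x * y) - (u' + (v + x * y'))) with ((u - u') + x * (y - y')) by ring end.
    eapply Rle_trans; [apply Rabs_triang|].
    replace ((C + 10 * D) * K * d ^ 3) with (C * K * d ^ 3 + K * (10 * D * d ^ 3)) by ring.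
    apply Rplus_le_compat.
    + eapply IH; eauto. intros; apply Hb; lia.
    + rewrite Rabs_mult. apply Rmult_le_compat; try apply Rabs_pos; [apply Hb; lia|].
      rewrite <- Rmult_minus_distr_r, Rabs_mult.
      replace (10 * D * d ^ 3) with ((10 * d ^ 3) * D) by ring.
      apply Rmult_le_compat; try apply Rabs_pos.
      2:{ apply HR. apply COS_bound. }
      rewrite (sin_double_half (tau q t)), (cos_double_half (tau q t)), (sin_half_tau q Hq1).
      unfold oddW. rewrite (sin_double_half t), (cos_double_half t).
      set (s := sin (t / 2)). set (c := cos (t / 2)). set (z := cos (tau q t / 2)).
      assert (Hsc : s * s + c * c = 1) by apply sin_cos_half.
      assert (Hz : z * z = c * c + d * d * (s * s)).
      { unfold z. rewrite (cos_half_tau_sqr q Hq1). fold s c. replace (1 - q * q) with (d * d) by lra. reflexivity. }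
      assert (Q := cube_error q d c s z Hq Hd Hqd (half_range t Ht) (cos_half_tau_pos q t) Hsc Hz).
      replace (q * (2 * s * c) * (2 - q ^ 3 + q ^ 3 * (1 - 2 * s * s)) - 2 * (q * s) * z * (1 + (1 - 2 * (q * s) * (q * s))))
        with ((- 4 * q * s) * (z ^ 3 - c * (c * c + (1 - q ^ 3) * (s * s)))).
      2:{ replace (z ^ 3) with (z * (z * z)) by ring. rewrite Hz.
          replace (c * c) with (1 - s * s) by lra. replace (d * d) with (1 - q * q) by lra. ring. }
      rewrite Rabs_mult.
      assert (B : Rabs (- 4 * q * s) <= 4) by (apply Rabs_le; split; nra).
      assert (P1 := Rabs_pos (- 4 * q * s)). assert (P2 := Rabs_pos (z ^ 3 - c * (c * c + (1 - q ^ 3) * (s * s)))). nra.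
Qed.

Lemma contraction_exists m : exists C, 0 <= C /\ forall q d M A B f,
  0 < q -> 0 < d -> q * q + d * d = 1 -> lead m A B f -> (forall t, Rabs (f t) <= M) ->
  derivable_pt_lim f PI 0 ->
  exists F, lead m ((q * q) ^ S m * A) ((q * q) ^ S m * B) F /\
    forall t, - PI <= t <= PI -> Rabs (F t - f (tau q t)) <= C * M * d ^ 3.
Proof.
  destruct (contraction_error (S m)) as [C [HC H]].
  exists (C * 2 ^ S m). split; [apply Rmult_le_pos; [exact HC|apply pow_le; lra]|].
  intros q d M A B f Hq Hd Hqd [g [[a [b Hg]] Hf]] HM Hder.
  set (a' := fun k => if Nat.eqb k (S m) then A else a k).
  set (b' := fun k => if Nat.eqb k (S m) then B else b k).
  assert (Ea : a' (S m) = A) by (unfold a'; now rewrite Nat.eqb_refl).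
  assert (Eb : b' (S m) = B) by (unfold b'; now rewrite Nat.eqb_refl).
  assert (E : f = trig_poly (S m) a' b').
  { extensionality t. rewrite Hf, Hg. unfold trig_poly. cbn [trig_sum]. rewrite Ea, Eb.
    rewrite (trig_sum_ext m a b a' b'); [change (a' O) with (a O); ring|].
    intros k Hk. unfold a', b'. rewrite (proj2 (Nat.eqb_neq k (S m))) by lia. auto. }
  assert (M0 : 0 <= M) by (eapply Rle_trans; [apply Rabs_pos|apply (HM 0)]).
  assert (Hsl : slope (S m) b' = 0) by (apply (slope_zero _ a'); now rewrite <- E).
  exists (contraction q (S m) a' b'). split.
  - assert (L := comb_lead a' b' (fun k t => cheb k (q * q * cos t + (1 - q * q)))
       (fun k t => oddW q t * chebR k (q * q * cos t + (1 - q * q)))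
       (fun k => (q * q) ^ S k) (fun k => match k with O => 0 | _ => (q * q) ^ S k end) m).
    rewrite Ea, Eb in L. unfold contraction.
    (* At order one the sine term is lost altogether, but there the vanishing slope says that [B]
       itself is 0. *)
    assert (E0 : match m with O => 0 | _ => (q * q) ^ S m end * B = (q * q) ^ S m * B).
    { destruct m as [|m]; [|reflexivity].
      simpl in Hsl. rewrite Eb in Hsl. unfold chebU_at_m1 in Hsl. simpl in Hsl.
      replace B with 0 by lra. ring. }
    rewrite E0 in L. apply L.
    + intros k. apply cheb_lead.
    + intros [|k]; [|apply chebR_lead].
      exists (fun _ => 0). split; [apply trig_const|]. intros t. simpl. ring.
  - intros t Ht. rewrite E. unfold contraction, trig_poly. rewrite trig_sum_slope, Hsl.
    match goal with |- Rabs (?u + ?v - (?u + (?w + 0 * ?x))) <= _ =>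
      replace (u + v - (u + (w + 0 * x))) with (v - w) by ring end.
    replace (C * 2 ^ S m * M * d ^ 3) with (C * (2 ^ S m * M) * d ^ 3) by ring.
    apply H; auto.
    + apply Rmult_le_pos; [apply pow_le; lra|exact M0].
    + intros k Hk. apply (coef_bound (S m) a' b' M); [|exact Hk]. intros. rewrite <- E. apply HM.
Qed.

(** * Variation near the fold point *)

Lemma sin_mult_bound k x : Rabs (sin (INR k * x)) <= INR k * Rabs (sin x).
Proof.
  induction k as [|k IH].
  - simpl. rewrite !Rmult_0_l, sin_0, Rabs_R0. lra.
  - rewrite S_INR, Rmult_plus_distr_r, Rmult_1_l, sin_plus.
    eapply Rle_trans; [apply Rabs_triang|]. rewrite !Rabs_mult.
    assert (A : Rabs (cos x) <= 1) by (apply Rabs_le, COS_bound).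
    assert (B : Rabs (cos (INR k * x)) <= 1) by (apply Rabs_le, COS_bound).
    assert (P1 := Rabs_pos (sin (INR k * x))). assert (P2 := Rabs_pos (sin x)).
    assert (P3 := Rabs_pos (cos x)). assert (P4 := Rabs_pos (cos (INR k * x))). nra.
Qed.

Lemma harmonic_near_PI k t :
  Rabs (cos (INR k * t) - cos (INR k * PI)) <= 2 * INR k * Rabs (cos (t / 2)) /\
  Rabs (sin (INR k * t) - sin (INR k * PI)) <= 2 * INR k * Rabs (cos (t / 2)).
Proof.
  rewrite form2, form4.
  replace ((INR k * t - INR k * PI) / 2) with (INR k * (t / 2 - PI / 2)) by field.
  assert (E : Rabs (sin (t / 2 - PI / 2)) = Rabs (cos (t / 2))).
  { rewrite sin_minus, cos_PI2, sin_PI2.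
    replace (sin (t / 2) * 0 - cos (t / 2) * 1) with (- cos (t / 2)) by ring. apply Rabs_Ropp. }
  assert (H := sin_mult_bound k (t / 2 - PI / 2)). rewrite E in H.
  assert (P := Rabs_pos (sin (INR k * (t / 2 - PI / 2)))).
  rewrite !Rabs_mult, (Rabs_left (-2)), (Rabs_right 2) by lra.
  set (u := (INR k * t + INR k * PI) / 2).
  assert (A : Rabs (sin u) <= 1) by (apply Rabs_le, SIN_bound).
  assert (B : Rabs (cos u) <= 1) by (apply Rabs_le, COS_bound).
  assert (A' := Rabs_pos (sin u)). assert (B' := Rabs_pos (cos u)). split; nra.
Qed.

(** A Lipschitz estimate at pi in terms of cos (t/2), because the comparison of cos (t/2) with [d]
    decides whether a point lies in the image of [tau]. *)
Lemma trig_near_PI n : exists C, 0 <= C /\ forall f M t, trig n f -> (forall t, Rabs (f t) <= M) ->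
  Rabs (f t - f PI) <= C * M * Rabs (cos (t / 2)).
Proof.
  cut (exists C, 0 <= C /\ forall a b K t,
    (forall k, (1 <= k <= n)%nat -> Rabs (a k) <= K /\ Rabs (b k) <= K) ->
    0 <= K -> Rabs (trig_sum n a b t - trig_sum n a b PI) <= C * K * Rabs (cos (t / 2))).
  { intros [C [HC H]]. exists (C * 2 ^ n). split; [apply Rmult_le_pos; [exact HC|apply pow_le; lra]|].
    intros f M t [a [b Hf]] HM. rewrite !Hf. unfold trig_poly.
    replace (a O / 2 + trig_sum n a b t - (a O / 2 + trig_sum n a b PI))
      with (trig_sum n a b t - trig_sum n a b PI) by ring.
    rewrite (Rmult_assoc C). apply H.
    - apply coef_bound. intros s. rewrite <- Hf. apply HM.
    - apply Rmult_le_pos; [apply pow_le; lra|]. eapply Rle_trans; [apply Rabs_pos|apply (HM 0)]. }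
  induction n as [|n [C [HC IH]]].
  - exists 0. split; [lra|]. intros. simpl. rewrite Rminus_0_r, Rabs_R0. lra.
  - exists (C + 4 * INR (S n)). assert (Pn := INR_S_pos n). split; [lra|]. intros a b K t Hab HK.
    cbn [trig_sum]. destruct (harmonic_near_PI (S n) t) as [H1 H2].
    destruct (Hab (S n)) as [Ha Hb]; [lia|].
    match goal with |- Rabs (?u + (?x * ?c + ?y * ?s) - (?u' + (?x * ?c' + ?y * ?s'))) <= _ =>
      replace (u + (x * c + y * s) - (u' + (x * c' + y * s')))
        with ((u - u') + (x * (c - c') + y * (s - s'))) by ring end.
    eapply Rle_trans; [apply Rabs_triang|].
    replace ((C + 4 * INR (S n)) * K * Rabs (cos (t / 2)))
      with (C * K * Rabs (cos (t / 2)) + (K * (2 * INR (S n) * Rabs (cos (t / 2))) + K * (2 * INR (S n) * Rabs (cos (t / 2))))) by ring.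
    apply Rplus_le_compat; [apply IH; [intros; apply Hab; lia|exact HK]|].
    eapply Rle_trans; [apply Rabs_triang|]. rewrite !Rabs_mult.
    apply Rplus_le_compat; apply Rmult_le_compat; auto using Rabs_pos.
Qed.

(** * Disjoint intervals *)

(** Touching and degenerate intervals are allowed, so cutting, gluing and mapping create no special
    cases. *)
Fixpoint chain (lo : R) (l : list (R * R)) (hi : R) : Prop :=
  match l with
  | [] => lo <= hi
  | (a, b) :: l' => lo <= a /\ a <= b /\ chain b l' hi
  end.

Fixpoint total (l : list (R * R)) : R :=
  match l with [] => 0 | (a, b) :: l' => (b - a) + total l' end.

Definition on_intervals (P : R -> Prop) (l : list (R * R)) : Prop :=
  forall a b, In (a, b) l -> forall t, a <= t <= b -> P t.

Definition map_ends (h : R -> R) : list (R * R) -> list (R * R) := map (fun p => (h (fst p), h (snd p))).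

Lemma on_intervals_cons P a b l : on_intervals P ((a, b) :: l) <->
  (forall t, a <= t <= b -> P t) /\ on_intervals P l.
Proof.
  unfold on_intervals. split.
  - intros H. split; intros; eapply H; simpl; eauto.
  - intros [H1 H2] a' b' [E|E]; [injection E as <- <-; auto|eauto].
Qed.

Lemma on_intervals_app P l l' : on_intervals P l -> on_intervals P l' -> on_intervals P (l ++ l').
Proof. intros H H' a b Hin. apply in_app_or in Hin. destruct Hin; [eapply H|eapply H']; eauto. Qed.

Lemma chain_le lo l hi : chain lo l hi -> lo <= hi.
Proof.
  revert lo. induction l as [|[a b] l IH]; intros lo H; [exact H|].
  destruct H as [H1 [H2 H3]]. apply IH in H3. lra.
Qed.

Lemma chain_weaken lo lo' l hi : lo' <= lo -> chain lo l hi -> chain lo' l hi.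
Proof. destruct l as [|[a b] l]; simpl; [lra|]. intros H [H1 H2]. split; [lra|exact H2]. Qed.

Lemma chain_app lo l m l' hi : chain lo l m -> chain m l' hi -> chain lo (l ++ l') hi.
Proof.
  revert lo. induction l as [|[a b] l IH]; intros lo H H'; simpl in *.
  - eapply chain_weaken; eauto.
  - destruct H as [H1 [H2 H3]]. auto.
Qed.

Lemma total_app l l' : total (l ++ l') = total l + total l'.
Proof. induction l as [|[a b] l IH]; simpl; [ring|]. rewrite IH. ring. Qed.

Lemma chain_in lo l hi a b : chain lo l hi -> In (a, b) l -> lo <= a /\ a <= b /\ b <= hi.
Proof.
  revert lo. induction l as [|[a' b'] l IH]; intros lo H Hin; [destruct Hin|].
  destruct H as [H1 [H2 H3]]. destruct Hin as [E|Hin].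
  - injection E as -> ->. apply chain_le in H3. lra.
  - apply (IH b') in Hin; [|exact H3]. lra.
Qed.

Lemma chain_total lo l hi : chain lo l hi -> 0 <= total l <= hi - lo.
Proof.
  revert lo. induction l as [|[a b] l IH]; intros lo H; simpl in *; [lra|].
  destruct H as [H1 [H2 H3]]. apply IH in H3. lra.
Qed.

Lemma chain_map h lo l hi lo' hi' (P : R -> Prop) : chain lo l hi -> on_intervals P l ->
  (forall x y, P x -> P y -> x <= y -> h x <= h y) -> (forall x, P x -> lo' <= h x <= hi') ->
  lo' <= hi' -> chain lo' (map_ends h l) hi'.
Proof.
  intros H Hl Hh Hr Hlo.
  (* [h] is monotone only on [P], and gaps may leave [P]; the induction therefore starts the image
     list at [h x] for an arbitrary [x] of [P] left of the list. *)
  cut (forall lo, chain lo l hi -> lo' <= hi' /\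
     (forall x, P x -> x <= lo -> chain (h x) (map_ends h l) hi') /\ chain lo' (map_ends h l) hi').
  { intros Q. apply (Q lo H). }
  clear H lo. induction l as [|[a b] l IH]; intros lo H; simpl.
  - repeat split; auto. intros x Hx _. now apply Hr.
  - destruct H as [H1 [H2 H3]]. apply on_intervals_cons in Hl. destruct Hl as [Hab Hl].
    destruct (IH Hl b H3) as [_ [Q _]].
    assert (Pa : P a) by (apply Hab; lra). assert (Pb : P b) by (apply Hab; lra).
    repeat split; auto.
    + apply Hh; auto. lra.
    + apply Q; [exact Pb|lra].
    + now apply Hr.
    + apply Q; [exact Pb|lra].
Qed.

Lemma chain_split P m : forall lo l hi, chain lo l hi -> on_intervals P l -> lo <= m <= hi ->
  exists l1 l2, chain lo l1 m /\ chain m l2 hi /\ total l1 + total l2 = total l /\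
    on_intervals P l1 /\ on_intervals P l2.
Proof.
  intros lo l. revert lo. induction l as [|[a b] l IH]; intros lo hi H Hl Hm.
  - exists [], []. simpl. repeat split; try lra; intros x y [].
  - destruct H as [H1 [H2 H3]]. assert (Hl' := Hl). apply on_intervals_cons in Hl'. destruct Hl' as [Hab Hl'].
    destruct (Rle_dec m a) as [Hma|Hma]; [|destruct (Rle_dec m b) as [Hmb|Hmb]].
    + exists [], ((a, b) :: l). simpl. repeat split; try lra; [exact H3|intros x y []|exact Hl].
    + exists [(a, m)], ((m, b) :: l). simpl. repeat split; try lra; [exact H3| |].
      * apply on_intervals_cons. split; [|intros x y []]. intros t Ht. apply Hab. lra.
      * apply on_intervals_cons. split; [|exact Hl']. intros t Ht. apply Hab. lra.
    + destruct (IH b hi H3 Hl') as [l1 [l2 [C1 [C2 [T [G1 G2]]]]]]; [lra|].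
      exists ((a, b) :: l1), l2. simpl. repeat split; try lra; auto.
      apply on_intervals_cons. auto.
Qed.

Lemma total_shift s l : total (map_ends (fun t => t + s) l) = total l.
Proof. induction l as [|[a b] l IH]; simpl; [reflexivity|]. rewrite IH. ring. Qed.

Lemma chain_shift s lo l hi : chain lo l hi -> chain (lo + s) (map_ends (fun t => t + s) l) (hi + s).
Proof.
  revert lo. induction l as [|[a b] l IH]; intros lo H; simpl in *; [lra|].
  destruct H as [H1 [H2 H3]]. repeat split; try lra. auto.
Qed.

Lemma on_intervals_shift P s l : on_intervals P l -> on_intervals (fun t => P (t - s)) (map_ends (fun t => t + s) l).
Proof.
  intros H a b Hin t Ht. apply in_map_iff in Hin. destruct Hin as [[x y] [E Hin]].
  simpl in E. injection E as <- <-. apply (H x y Hin). lra.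
Qed.

(** On a circle the starting point is arbitrary: the part before [c] moves to the end by one
    period. *)
Lemma recut (P : R -> Prop) lo l c T : (forall t, P t -> P (t + T)) -> chain lo l (lo + T) ->
  on_intervals P l -> lo <= c <= lo + T ->
  exists l', chain c l' (c + T) /\ total l' = total l /\ on_intervals P l'.
Proof.
  intros HP H Hl Hc. destruct (chain_split P c lo l (lo + T) H Hl Hc) as [l1 [l2 [C1 [C2 [E [G1 G2]]]]]].
  exists (l2 ++ map_ends (fun t => t + T) l1). repeat split.
  - eapply chain_app; [exact C2|]. now apply chain_shift.
  - rewrite total_app, total_shift. lra.
  - apply on_intervals_app; [exact G2|]. apply (on_intervals_shift P T) in G1.
    intros a b Hin t Ht. replace t with ((t - T) + T) by ring. apply HP. now apply (G1 a b).
Qed.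

(** * Comparison of image lengths with that of a centred arc *)

Lemma nondecreasing_of_deriv h h' a b : a <= b ->
  (forall t, a <= t <= b -> derivable_pt_lim h t (h' t)) -> (forall t, a <= t <= b -> 0 <= h' t) -> h a <= h b.
Proof.
  intros Hab Hd Hp. destruct Hab as [Hab| ->]; [|lra].
  destruct (MVT_cor2 h h' a b Hab Hd) as [c [E Hc]].
  assert (0 <= h' c) by (apply Hp; lra). nra.
Qed.

Definition clip (x0 x : R) : R := Rmax (- x0) (Rmin x0 x).

Lemma clip_range x0 x : 0 <= x0 -> - x0 <= clip x0 x <= x0.
Proof. intros H. unfold clip, Rmax, Rmin. repeat destruct Rle_dec; lra. Qed.

Lemma clip_mono x0 x y : x <= y -> clip x0 x <= clip x0 y.
Proof. intros H. unfold clip, Rmax, Rmin. repeat destruct Rle_dec; lra. Qed.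

(* Bathtub principle: with a weight [w] that is even and increases away from 0, subtracting the constant
   [w x0] leaves a function that decreases exactly on [[-x0, x0]]. *)
Section Bathtub.
Variables (g w : R -> R) (B x0 : R).
Hypothesis Hder : forall t, - B < t < B -> derivable_pt_lim g t (w t).
Hypothesis Hmono : forall s t, Rabs s <= Rabs t -> Rabs t < B -> w s <= w t.
Hypothesis Hx0 : 0 <= x0 < B.

Let D (t : R) : R := g t - w x0 * t.

Lemma tilt_deriv t : - B < t < B -> derivable_pt_lim D t (w t - w x0).
Proof.
  intros Ht. apply derivable_pt_lim_minus; [now apply Hder|].
  rewrite <- (Rmult_1_r (w x0)) at 2.
  apply (derivable_pt_lim_scal (fun t => t)). apply derivable_pt_lim_id.
Qed.

Lemma tilt_decreasing_inside s t : - x0 <= s -> s <= t -> t <= x0 -> D t <= D s.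
Proof.
  intros H1 H2 H3. apply Ropp_le_cancel.
  apply (nondecreasing_of_deriv (fun t => - D t) (fun t => - (w t - w x0))); [exact H2| |].
  - intros u Hu. apply derivable_pt_lim_opp, tilt_deriv. lra.
  - intros u Hu. cut (w u <= w x0); [lra|]. apply Hmono; rewrite (Rabs_right x0) by lra; [|lra].
    apply Rabs_le. lra.
Qed.

Lemma tilt_increasing_outside s t : - B < s -> s <= t -> t < B -> t <= - x0 \/ x0 <= s -> D s <= D t.
Proof.
  intros H1 H2 H3 H4.
  apply (nondecreasing_of_deriv D (fun t => w t - w x0)); [exact H2| |].
  - intros u Hu. apply tilt_deriv. lra.
  - intros u Hu. cut (w x0 <= w u); [lra|]. apply Hmono; [|apply Rabs_def1; lra].
    rewrite (Rabs_right x0) by lra. destruct H4.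
    + rewrite Rabs_left1; lra.
    + rewrite Rabs_right; lra.
Qed.

(** What clipping removes from [[s, t]] lies where [D] increases. *)
Lemma tilt_clip s t : - B < s -> s <= t -> t < B -> D (clip x0 t) - D (clip x0 s) <= D t - D s.
Proof.
  intros H1 H2 H3.
  assert (C1 : forall x, x <= - x0 -> clip x0 x = - x0) by
    (intros x Hx; unfold clip, Rmax, Rmin; repeat destruct Rle_dec; lra).
  assert (C2 : forall x, - x0 <= x <= x0 -> clip x0 x = x) by
    (intros x Hx; unfold clip, Rmax, Rmin; repeat destruct Rle_dec; lra).
  assert (C3 : forall x, x0 <= x -> clip x0 x = x0) by
    (intros x Hx; unfold clip, Rmax, Rmin; repeat destruct Rle_dec; lra).
  assert (EL : forall x, - B < x -> x <= - x0 -> D x <= D (- x0)) by (intros; apply tilt_increasing_outside; lra).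
  assert (ER : forall x, x0 <= x -> x < B -> D x0 <= D x) by (intros; apply tilt_increasing_outside; lra).
  destruct (Rle_dec s (- x0)) as [s1|s1]; [|destruct (Rle_dec s x0) as [s2|s2]];
  (destruct (Rle_dec t (- x0)) as [t1|t1]; [|destruct (Rle_dec t x0) as [t2|t2]]); try lra.
  - rewrite !C1 by lra. assert (D s <= D t) by (apply tilt_increasing_outside; lra). lra.
  - rewrite (C1 s), (C2 t) by lra. assert (Q := EL s). lra.
  - rewrite (C1 s), (C3 t) by lra. assert (Q := EL s). assert (Q' := ER t). lra.
  - rewrite (C2 s), (C2 t) by lra. lra.
  - rewrite (C2 s), (C3 t) by lra. assert (Q' := ER t). lra.
  - rewrite !C3 by lra. assert (D s <= D t) by (apply tilt_increasing_outside; lra). lra.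
Qed.

(** The sum of the increments of [D] over the intervals only drops when these are clipped, and again
    when the clipped gaps are added, since [D] decreases on [-x0, x0]; then it telescopes. *)
Lemma bathtub_chain lo l hi : chain lo l hi -> on_intervals (fun t => - B < t < B) l ->
  w x0 * total l + (D (clip x0 hi) - D (clip x0 lo)) <= total (map_ends g l).
Proof.
  assert (Hdec : forall s t, s <= t -> D (clip x0 t) <= D (clip x0 s)).
  { intros s t Hst. apply tilt_decreasing_inside; [apply clip_range; lra|now apply clip_mono|apply clip_range; lra]. }
  revert lo. induction l as [|[a b] l IH]; intros lo H Hl.
  - simpl in *. assert (Q := Hdec lo hi H). lra.
  - destruct H as [H1 [H2 H3]]. apply on_intervals_cons in Hl. destruct Hl as [Hab Hl].
    specialize (IH b H3 Hl). simpl. assert (Q := Hdec lo a H1).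
    assert (Ra := Hab a ltac:(lra)). assert (Rb := Hab b ltac:(lra)).
    assert (Q' := tilt_clip a b ltac:(lra) H2 ltac:(lra)).
    assert (E : D b - D a = g b - g a - w x0 * (b - a)) by (unfold D; ring). nra.
Qed.
End Bathtub.

(** Strictness puts half the total length inside the open interval where the weight is defined. *)
Lemma total_interior lo l hi B : 0 < B -> chain lo l hi -> on_intervals (fun t => - B < t < B) l ->
  total l < 2 * B.
Proof.
  intros HB.
  assert (Q : forall l lo, - B < lo < B -> chain lo l hi -> on_intervals (fun t => - B < t < B) l -> total l < B - lo).
  { clear l lo. induction l as [|[a b] l IH]; intros lo Hlo H Hl; simpl; [lra|].
    destruct H as [H1 [H2 H3]]. apply on_intervals_cons in Hl. destruct Hl as [Hab Hl].
    assert (Rb := Hab b ltac:(lra)). specialize (IH b Rb H3 Hl). lra. }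
  destruct l as [|[a b] l]; intros H Hl; [simpl; lra|].
  assert (Ra : - B < a < B).
  { destruct H as [_ [H2 _]]. apply on_intervals_cons in Hl. apply (proj1 Hl). lra. }
  assert (T := Q ((a, b) :: l) a Ra). destruct H as [H1 [H2 H3]].
  assert (total ((a, b) :: l) < B - a) by (apply T; [repeat split; auto; lra|exact Hl]). lra.
Qed.

Lemma bathtub g w B l : 0 < B ->
  (forall t, - B < t < B -> derivable_pt_lim g t (w t)) ->
  (forall s t, Rabs s <= Rabs t -> Rabs t < B -> w s <= w t) ->
  (forall t, g (- t) = - g t) ->
  chain (- PI) l PI -> on_intervals (fun t => - B < t < B) l -> B <= PI ->
  2 * g (total l / 2) <= total (map_ends g l).
Proof.
  intros HB Hder Hmono Hodd Hl Hin HBP.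
  assert (T0 := chain_total _ _ _ Hl). assert (T1 := total_interior _ _ _ B HB Hl Hin).
  set (x0 := total l / 2). assert (Hx0 : 0 <= x0 < B) by (unfold x0; lra).
  assert (Q := bathtub_chain g w B x0 Hder Hmono Hx0 _ _ _ Hl Hin).
  assert (C1 : clip x0 PI = x0) by (unfold clip, Rmax, Rmin; repeat destruct Rle_dec; lra).
  assert (C2 : clip x0 (- PI) = - x0) by (unfold clip, Rmax, Rmin; repeat destruct Rle_dec; lra).
  rewrite C1, C2, Hodd in Q. replace (total l) with (2 * x0) in Q by (unfold x0; field). lra.
Qed.

(** [bathtub_chain] on either side of the hole; the decrease of [D] across [[u, v]] is left over and
    is the gain. *)
Lemma bathtub_hole g w B l1 l2 u v x0 : 0 < B ->
  (forall t, - B < t < B -> derivable_pt_lim g t (w t)) ->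
  (forall s t, Rabs s <= Rabs t -> Rabs t < B -> w s <= w t) ->
  (forall t, g (- t) = - g t) -> B <= PI ->
  2 * x0 = total l1 + total l2 ->
  - x0 <= u -> u <= v -> v <= x0 ->
  chain (- PI) l1 u -> chain v l2 PI ->
  on_intervals (fun t => - B < t < B) l1 -> on_intervals (fun t => - B < t < B) l2 ->
  2 * g x0 + (w x0 * (v - u) - (g v - g u)) <= total (map_ends g l1) + total (map_ends g l2).
Proof.
  intros HB Hder Hmono Hodd HBP Hx Hu Huv Hv C1 C2 H1 H2.
  assert (T0 := chain_total _ _ _ C1). assert (T1 := chain_total _ _ _ C2).
  assert (T2 : total (l1 ++ l2) < 2 * B).
  { apply (total_interior (- PI) _ PI B HB); [|now apply on_intervals_app].
    apply (chain_app _ _ u); [exact C1|]. eapply chain_weaken; eauto. }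
  rewrite total_app in T2.
  assert (Hx0 : 0 <= x0 < B) by lra.
  assert (Q1 := bathtub_chain g w B x0 Hder Hmono Hx0 _ _ _ C1 H1).
  assert (Q2 := bathtub_chain g w B x0 Hder Hmono Hx0 _ _ _ C2 H2).
  assert (E1 : clip x0 PI = x0) by (unfold clip, Rmax, Rmin; repeat destruct Rle_dec; lra).
  assert (E2 : clip x0 (- PI) = - x0) by (unfold clip, Rmax, Rmin; repeat destruct Rle_dec; lra).
  assert (E3 : clip x0 u = u) by (unfold clip, Rmax, Rmin; repeat destruct Rle_dec; lra).
  assert (E4 : clip x0 v = v) by (unfold clip, Rmax, Rmin; repeat destruct Rle_dec; lra).
  rewrite E1, E4 in Q2. rewrite E2, E3, Hodd in Q1. nra.
Qed.

(** * The inverse of the contraction and its density *)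

Definition phi (q t : R) : R := 2 * asin (sin (t / 2) / q).

(** The derivative cos (t/2) / sqrt (q^2 - sin^2 (t/2)) of [phi q], rewritten by q^2 + d^2 = 1 to
    show its growth as cos (t/2) decreases. *)
Definition phi' (d t : R) : R := / sqrt (1 - d * d / (cos (t / 2) * cos (t / 2))).

Section Phi.
Variables q d : R.
Hypothesis Hq : 0 < q.
Hypothesis Hd : 0 < d.
Hypothesis Hqd : q * q + d * d = 1.

Let B := 2 * asin q.

Lemma contraction_lt1 : q < 1. Proof. nra. Qed.

Lemma two_asin_range : 0 < B < PI.
Proof.
  assert (q1 := contraction_lt1). assert (b := asin_bound q).
  assert (S : sin (asin q) = q) by (apply sin_asin; lra).
  unfold B. split.
  - destruct (Rle_dec (asin q) 0) as [H|H]; [|lra].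
    assert (sin (asin q) <= 0) by (rewrite <- sin_0; apply sin_incr_1; lra). lra.
  - destruct (Rlt_dec (asin q) (PI / 2)) as [H|H]; [lra|].
    replace (asin q) with (PI / 2) in S by lra. rewrite sin_PI2 in S. lra.
Qed.

Lemma sin_half_lt t : - PI <= t <= PI -> (- B < t < B <-> - q < sin (t / 2) < q).
Proof.
  intros Ht. assert (q1 := contraction_lt1). assert (b := two_asin_range).
  assert (S : sin (asin q) = q) by (apply sin_asin; lra).
  assert (S' : sin (- asin q) = - q) by (rewrite sin_neg; lra).
  assert (Bq : B = 2 * asin q) by reflexivity. split; intros H.
  - split; [rewrite <- S'|rewrite <- S]; apply sin_increasing_1; lra.
  - split.
    + cut (- asin q < t / 2); [lra|]. apply sin_increasing_0; lra.
    + cut (t / 2 < asin q); [lra|]. apply sin_increasing_0; lra.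
Qed.

Lemma phi_odd t : phi q (- t) = - phi q t.
Proof.
  unfold phi. replace (- t / 2) with (- (t / 2)) by field. rewrite sin_neg.
  replace (- sin (t / 2) / q) with (- (sin (t / 2) / q)) by (field; lra). rewrite asin_opp. ring.
Qed.

Lemma phi_range t : - PI <= phi q t <= PI.
Proof. unfold phi. assert (H := asin_bound (sin (t / 2) / q)). lra. Qed.

Lemma sin_half_phi t : - B < t < B -> sin (phi q t / 2) = sin (t / 2) / q.
Proof.
  intros Ht. assert (b := two_asin_range). apply sin_half_lt in Ht; [|lra].
  unfold phi. replace (2 * asin (sin (t / 2) / q) / 2) with (asin (sin (t / 2) / q)) by field.
  apply sin_asin. split.
  - apply Rle_div_r; lra.
  - apply Rle_div_l; lra.
Qed.

Lemma phi_mono s t : - B < s < B -> - B < t < B -> s <= t -> phi q s <= phi q t.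
Proof.
  intros Hs Ht Hst. assert (b := two_asin_range).
  assert (Rs := phi_range s). assert (Rt := phi_range t).
  cut (phi q s / 2 <= phi q t / 2); [lra|].
  apply sin_incr_0; try lra. rewrite !sin_half_phi by assumption.
  apply Rmult_le_compat_r; [left; now apply Rinv_0_lt_compat|]. apply sin_incr_1; lra.
Qed.

Lemma tau_phi t : - B < t < B -> tau q (phi q t) = t.
Proof.
  intros Ht. assert (b := two_asin_range). unfold tau. rewrite sin_half_phi by exact Ht.
  replace (q * (sin (t / 2) / q)) with (sin (t / 2)) by (field; lra).
  rewrite asin_sin by lra. field.
Qed.

Lemma tau_mono s t : - PI <= s -> s <= t -> t <= PI -> tau q s <= tau q t.
Proof.
  intros H1 H2 H3. assert (q1 := contraction_lt1).
  assert (Rs := tau_range q s). assert (Rt := tau_range q t).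
  cut (tau q s / 2 <= tau q t / 2); [lra|].
  apply sin_incr_0; try lra. rewrite !sin_half_tau by lra.
  apply Rmult_le_compat_l; [lra|]. apply sin_incr_1; lra.
Qed.

Lemma cos_half_gt t : - B < t < B -> 0 < cos (t / 2) /\ d * d < cos (t / 2) * cos (t / 2).
Proof.
  intros Ht. assert (b := two_asin_range). assert (S := proj1 (sin_half_lt t ltac:(lra)) Ht).
  assert (E := sin_cos_half t). split; [apply cos_gt_0; lra|nra].
Qed.

Lemma phi_deriv t : - B < t < B -> derivable_pt_lim (phi q) t (phi' d t).
Proof.
  intros Ht. destruct (cos_half_gt t Ht) as [c0 cd].
  assert (b := two_asin_range). assert (S := proj1 (sin_half_lt t ltac:(lra)) Ht).
  assert (E := sin_cos_half t).
  set (s := sin (t / 2)) in *. set (c := cos (t / 2)) in *.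
  assert (R1 : -1 < s / q < 1) by (split; [apply Rlt_div_r|apply Rlt_div_l]; lra).
  assert (D1 : derivable_pt_lim asin (s / q) (1 / sqrt (1 - (s / q)²))).
  { rewrite <- (derive_pt_asin _ R1). now apply derive_pt_eq_1 with (derivable_pt_asin _ R1). }
  assert (D0 : derivable_pt_lim (fun t => sin (t / 2) / q) t (c / 2 / q)).
  { apply is_derive_Reals. auto_derive; [exact I|]. change (t * / 2) with (t / 2). fold c. field. lra. }
  assert (D2 := derivable_pt_lim_comp (fun t => sin (t / 2) / q) asin t _ _ D0 D1).
  apply (derivable_pt_lim_scal _ 2) in D2.
  replace (phi' d t) with (2 * (1 / sqrt (1 - (s / q)²) * (c / 2 / q))); [exact D2|].
  unfold phi'. fold c.
  assert (P : 0 < q * q - s * s) by nra.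
  replace (1 - (s / q)²) with ((q * q - s * s) / (q * q)) by (unfold Rsqr; field; lra).
  replace (1 - d * d / (c * c)) with ((q * q - s * s) / (c * c)).
  2:{ replace (q * q - s * s) with (c * c - d * d) by lra. field. lra. }
  rewrite !sqrt_div_alt by nra. rewrite !sqrt_square by lra.
  assert (0 < sqrt (q * q - s * s)) by now apply sqrt_lt_R0.
  field. repeat split; lra.
Qed.

Lemma cos_half_abs_mono s t : Rabs s <= Rabs t -> Rabs t < PI -> cos (t / 2) <= cos (s / 2).
Proof.
  intros H Ht.
  assert (E : forall x, cos (x / 2) = cos (Rabs x / 2)).
  { intros x. unfold Rabs. destruct Rcase_abs; [|reflexivity].
    replace (- x / 2) with (- (x / 2)) by field. now rewrite cos_neg. }
  rewrite (E s), (E t). assert (P := Rabs_pos s). apply cos_decr_1; lra.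
Qed.

Lemma phi'_mono s t : Rabs s <= Rabs t -> Rabs t < B -> phi' d s <= phi' d t.
Proof.
  intros H Ht. assert (b := two_asin_range).
  assert (Ht' : - B < t < B) by (apply Rabs_def2 in Ht; lra).
  assert (C := cos_half_abs_mono s t H ltac:(lra)).
  destruct (cos_half_gt t Ht') as [c0 cd]. unfold phi'.
  set (ct := cos (t / 2)) in *. set (cs := cos (s / 2)) in *.
  assert (P : 0 < ct * ct) by nra. assert (P2 : ct * ct <= cs * cs) by nra.
  apply Rinv_le_contravar.
  - apply sqrt_lt_R0. cut (d * d / (ct * ct) < 1); [lra|]. apply Rlt_div_l; lra.
  - apply sqrt_le_1_alt. apply Rplus_le_compat_l, Ropp_le_contravar.
    apply Rmult_le_compat_l; [nra|]. now apply Rinv_le_contravar.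
Qed.

(* [1/sqrt (1 - x)] has derivative at least [1/2]. *)
Lemma phi'_gain s t : Rabs s <= Rabs t -> Rabs t < B ->
  phi' d s + d * d / 2 * (/ (cos (t / 2) * cos (t / 2)) - / (cos (s / 2) * cos (s / 2))) <= phi' d t.
Proof.
  intros H Ht. assert (b := two_asin_range).
  assert (Ht' : - B < t < B) by (apply Rabs_def2 in Ht; lra).
  assert (C := cos_half_abs_mono s t H ltac:(lra)).
  destruct (cos_half_gt t Ht') as [c0 cd]. unfold phi'.
  set (ct := cos (t / 2)) in *. set (cs := cos (s / 2)) in *.
  assert (P : 0 < ct * ct) by nra. assert (P2 : ct * ct <= cs * cs) by nra.
  set (vt := / (ct * ct)). set (vs := / (cs * cs)).
  assert (V : 0 < vs <= vt).
  { split; [apply Rinv_0_lt_compat; lra|]. now apply Rinv_le_contravar. }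
  assert (V1 : d * d * vt < 1) by (apply Rlt_div_l; lra).
  change (d * d / (cs * cs)) with (d * d * vs). change (d * d / (ct * ct)) with (d * d * vt).
  assert (dd : 0 < d * d) by nra.
  set (xs := 1 - d * d * vs). set (xt := 1 - d * d * vt).
  assert (X : 0 < xt /\ xt <= xs /\ xs <= 1) by (unfold xt, xs; repeat split; nra).
  replace (d * d / 2 * (vt - vs)) with ((xs - xt) / 2) by (unfold xs, xt; field).
  destruct X as [X1 [X2 X3]].
  assert (S1 := sqrt_sqrt xt ltac:(lra)). assert (S2 := sqrt_sqrt xs ltac:(lra)).
  assert (S3 := sqrt_lt_R0 xt X1). assert (S4 := sqrt_le_1_alt _ _ X2).
  assert (S5 : sqrt xs <= 1) by (rewrite <- sqrt_1; now apply sqrt_le_1_alt).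
  set (a := sqrt xt) in *. set (e := sqrt xs) in *. rewrite <- S1, <- S2.
  cut ((e * e - a * a) / 2 <= / a - / e); [lra|].
  replace (/ a - / e) with ((e - a) / (a * e)) by (field; lra).
  apply (Rmult_le_reg_r (a * e)); [nra|].
  replace ((e - a) / (a * e) * (a * e)) with (e - a) by (field; lra).
  assert (Q1 : 0 <= e - a) by lra. assert (Q2 : (e + a) / 2 * (a * e) <= 1).
  { assert (a * e <= 1) by nra. assert ((e + a) / 2 <= 1) by lra.
    rewrite <- (Rmult_1_r 1). apply Rmult_le_compat; nra. }
  replace ((e * e - a * a) / 2 * (a * e)) with ((e - a) * ((e + a) / 2 * (a * e))) by field.
  rewrite <- (Rmult_1_r (e - a)) at 2. now apply Rmult_le_compat_l.
Qed.
End Phi.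

(** * The inequality [y * sin (L / 4) ^ (2 n) <= 1] *)

Lemma periodic_Z (f : R -> R) T : (forall t, f (t + T) = f t) -> forall z t, f (t + IZR z * T) = f t.
Proof.
  intros H.
  assert (N : forall k t, f (t + INR k * T) = f t).
  { induction k as [|k IH]; intros t; [f_equal; simpl; ring|].
    rewrite S_INR. replace (t + (INR k + 1) * T) with ((t + INR k * T) + T) by ring. now rewrite H. }
  intros z t. destruct (Z.le_gt_cases 0 z) as [Hz|Hz].
  - rewrite <- (Z2Nat.id z Hz), <- INR_IZR_INZ. apply N.
  - rewrite <- (N (Z.to_nat (- z)) (t + IZR z * T)). f_equal.
    rewrite INR_IZR_INZ, Z2Nat.id by lia. rewrite opp_IZR. ring.
Qed.

Lemma period_reduce lo T t : 0 < T ->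
  exists s, lo <= s <= lo + T /\ exists z, t = s + IZR z * T.
Proof.
  intros HT. destruct (base_Int_part ((t - lo) / T)) as [H1 H2].
  set (z := Int_part ((t - lo) / T)) in *.
  exists (t - IZR z * T). split; [|exists z; ring].
  assert (E : (t - lo) / T * T = t - lo) by (field; lra). split; nra.
Qed.

Lemma trig_period_reduce n f lo t : trig n f -> exists s, lo <= s <= lo + 2 * PI /\ f t = f s.
Proof.
  intros Hf. assert (P := PI_RGT_0).
  destruct (period_reduce lo (2 * PI) t) as [s [Hs [z E]]]; [lra|].
  exists s. split; [exact Hs|]. rewrite E. apply periodic_Z. intros u. now apply (trig_periodic n).
Qed.

Lemma trig_derivable n f t : trig n f -> exists l, derivable_pt_lim f t l.
Proof.
  intros [a [b H]]. exists (0 + trig_sum n (fun k => INR k * b k) (fun k => - (INR k * a k)) t).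
  replace f with (fun t => a O / 2 + trig_sum n a b t) by (extensionality s; now rewrite H).
  apply (derivable_pt_lim_plus (fun _ => a O / 2) (trig_sum n a b)); [apply derivable_pt_lim_const|].
  apply trig_sum_deriv.
Qed.

Lemma deriv_shift f s x l : derivable_pt_lim f (x + s) l -> derivable_pt_lim (fun t => f (t + s)) x l.
Proof.
  intros H. rewrite <- (Rmult_1_r l). apply (derivable_pt_lim_comp (fun t => t + s) f); [|exact H].
  apply is_derive_Reals. auto_derive; [exact I|ring].
Qed.

Lemma deriv_at_max f c l : derivable_pt_lim f c l -> (forall t, f t <= f c) -> l = 0.
Proof.
  intros Hd Hm. assert (E := deriv_maximum f (c - 1) (c + 1) c (exist _ l Hd)).
  rewrite <- E; try lra; [|intros; apply Hm]. symmetry. now apply derive_pt_eq_0.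
Qed.

Lemma trig_max n f lo : trig n f -> exists c, lo <= c <= lo + 2 * PI /\
  (forall t, Rabs (f t) <= Rabs (f c)) /\ derivable_pt_lim f c 0.
Proof.
  intros Hf. assert (P := PI_RGT_0).
  destruct (continuity_ab_maj (fun t => Rabs (f t)) lo (lo + 2 * PI)) as [c [Hmax Hc]]; [lra| |].
  { intros t _. apply (continuity_pt_comp f Rabs); [apply (trig_continuity n f Hf)|apply Rcontinuity_abs]. }
  assert (HM : forall t, Rabs (f t) <= Rabs (f c)).
  { intros t. destruct (trig_period_reduce n f lo t Hf) as [s [Hs ->]]. now apply Hmax. }
  exists c. repeat split; try apply Hc; [exact HM|].
  destruct (trig_derivable n f c Hf) as [l Hl].
  assert (HM' : forall t, - Rabs (f c) <= f t <= Rabs (f c)) by (intros t; apply Rabs_le_between, HM).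
  destruct (Rle_dec 0 (f c)) as [Hp|Hp].
  - rewrite Rabs_right in HM' by lra.
    rewrite <- (deriv_at_max f c l Hl); [exact Hl|apply HM'].
  - rewrite Rabs_left in HM' by lra.
    assert (E := deriv_at_max (fun t => - f t) c (- l)).
    replace 0 with l; [exact Hl|]. cut (- l = 0); [lra|]. apply E; [now apply derivable_pt_lim_opp|].
    intros t. assert (Q := HM' t). lra.
Qed.

(** The height of [f] at pi forces cos (t/2) > d wherever |f| <= 1, so these points lie in the image
    of [tau]. The contraction exceeds the bounds 1 and [M] by at most C M d^3; dividing by 1 + C M
    d^3 restores both. *)
Lemma step_frame m : exists C, 0 <= C /\ forall q d M A B f l,
  0 < q -> 0 < d -> q * q + d * d = 1 -> 1 <= M -> lead m A B f -> (forall t, Rabs (f t) <= M) ->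
  derivable_pt_lim f PI 0 -> 1 + C * M * d < Rabs (f PI) ->
  chain (- PI) l PI -> on_intervals (fun t => Rabs (f t) <= 1) l ->
  exists F, lead m ((q * q) ^ S m / (1 + C * M * d ^ 3) * A) ((q * q) ^ S m / (1 + C * M * d ^ 3) * B) F /\
    (forall t, Rabs (F t) <= M) /\
    chain (- PI) (map_ends (phi q) l) PI /\
    on_intervals (fun t => Rabs (F t) <= 1) (map_ends (phi q) l) /\
    on_intervals (fun t => - (2 * asin q) < t < 2 * asin q) l.
Proof.
  destruct (contraction_exists m) as [C1 [HC1 H1]]. destruct (trig_near_PI (S m)) as [C2 [HC2 H2]].
  exists (Rmax C1 C2). assert (R1 := Rmax_l C1 C2). assert (R2 := Rmax_r C1 C2).
  set (C := Rmax C1 C2) in *. split; [lra|].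
  intros q d M A B f l Hq Hd Hqd HM1 Hf HM Hder Hbig Hl Hgood.
  assert (P := PI_RGT_0). assert (q1 := contraction_lt1 q d Hq Hd Hqd).
  assert (b := two_asin_range q d Hq Hd Hqd).
  assert (Hin : forall t, - PI <= t <= PI -> Rabs (f t) <= 1 -> - (2 * asin q) < t < 2 * asin q).
  { intros t Ht Hft. apply (sin_half_lt q d Hq Hd Hqd t Ht).
    assert (N := H2 f M t (lead_trig _ _ _ _ Hf) HM).
    assert (T := Rabs_triang (f PI - f t) (f t)). replace (f PI - f t + f t) with (f PI) in T by ring.
    rewrite Rabs_minus_sym in T.
    assert (c0 := half_range t Ht). rewrite (Rabs_right (cos (t / 2))) in N by lra.
    assert (Hc : d < cos (t / 2)).
    { destruct (Rle_dec (cos (t / 2)) d) as [Hle|Hle]; [|lra]. exfalso.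
      assert (C2 * M * cos (t / 2) <= C * M * d); [|lra].
      apply Rmult_le_compat; [nra|lra|nra|lra]. }
    assert (E := sin_cos_half t). split; nra. }
  destruct (H1 q d M A B f Hq Hd Hqd Hf HM Hder) as [G [HG HE]].
  assert (d3 : 0 < d ^ 3) by now apply pow_lt.
  set (K := 1 + C * M * d ^ 3).
  assert (HK : 1 <= K). { unfold K. assert (0 <= C * M * d ^ 3) by (apply Rmult_le_pos; nra). lra. }
  assert (HGK : forall t, - PI <= t <= PI -> forall N, 1 <= N -> Rabs (f (tau q t)) <= N -> Rabs (/ K * G t) <= N).
  { intros t Ht N HN Hft. specialize (HE t Ht).
    assert (T := Rabs_triang (G t - f (tau q t)) (f (tau q t))).
    replace (G t - f (tau q t) + f (tau q t)) with (G t) in T by ring.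
    rewrite Rabs_mult, Rabs_right by (left; apply Rinv_0_lt_compat; lra).
    apply (Rmult_le_reg_l K); [lra|]. rewrite <- Rmult_assoc, Rinv_r, Rmult_1_l by lra.
    assert (C1 * M * d ^ 3 <= C * M * d ^ 3) by (apply Rmult_le_compat_r; [lra|]; nra).
    unfold K in *. nra. }
  assert (LF := lead_scal _ _ _ _ (/ K) HG).
  assert (Hin' : on_intervals (fun t => - (2 * asin q) < t < 2 * asin q) l).
  { intros x y Hxy t Ht. apply Hin; [|now apply (Hgood x y)].
    apply (chain_in _ _ _ _ _ Hl) in Hxy. lra. }
  exists (fun t => / K * G t). repeat split.
  - revert LF. apply lead_ext; [field; lra|field; lra|reflexivity].
  - intros t. destruct (trig_period_reduce (S m) (fun t => / K * G t) (- PI) t) as [s [Hs ->]].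
    { eapply lead_trig, LF. }
    apply HGK; [lra|exact HM1|apply HM].
  - apply (chain_map _ _ _ _ _ _ (fun t => - (2 * asin q) < t < 2 * asin q) Hl Hin').
    + intros x y Hx Hy Hxy. now apply (phi_mono q d).
    + intros x _. apply phi_range.
    + lra.
  - intros x' y' Hxy t Ht. apply in_map_iff in Hxy. destruct Hxy as [[x y] [E Hxy]].
    simpl in E. injection E as <- <-.
    assert (Hxy' := chain_in _ _ _ _ _ Hl Hxy).
    assert (Hx := Hin' x y Hxy x ltac:(lra)). assert (Hy := Hin' x y Hxy y ltac:(lra)).
    assert (Rx := phi_range q x). assert (Ry := phi_range q y).
    apply HGK; [lra|lra|]. apply (Hgood x y Hxy).
    (* [tau] is monotone and inverts [phi], so [tau q t] falls back into [[x, y]]. *)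
    rewrite <- (tau_phi q d Hq Hd Hqd x Hx) at 1. rewrite <- (tau_phi q d Hq Hd Hqd y Hy).
    split; apply (tau_mono q d); auto; lra.
  - apply (Hin' a b0 H t H0).
  - apply (Hin' a b0 H t H0).
Qed.

Lemma sin_quarter L : 0 <= L <= 2 * PI -> 0 <= sin (L / 4) <= 1.
Proof. intros H. split; [apply sin_ge_0; assert (P := PI_RGT_0); lra|apply SIN_bound]. Qed.

(** The source of the quantity sin (L/4): the bathtub bound compares with [phi q (L / 2)], and sin
    (phi x / 2) = sin (x/2) / q. *)
Lemma phi_bathtub q d l : 0 < q -> 0 < d -> q * q + d * d = 1 -> chain (- PI) l PI ->
  chain (- PI) (map_ends (phi q) l) PI -> on_intervals (fun t => - (2 * asin q) < t < 2 * asin q) l ->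
  sin (total l / 4) <= q * sin (total (map_ends (phi q) l) / 4).
Proof.
  intros Hq Hd Hqd Hl Hl1 Hin. assert (b := two_asin_range q d Hq Hd Hqd).
  assert (T0 := chain_total _ _ _ Hl). assert (T1 := chain_total _ _ _ Hl1).
  assert (T2 := total_interior _ _ _ _ (proj1 b) Hl Hin).
  assert (Q := bathtub (phi q) (phi' d) (2 * asin q) l (proj1 b)
    (phi_deriv q d Hq Hd Hqd) (phi'_mono q d Hq Hd Hqd) (phi_odd q Hq) Hl Hin ltac:(lra)).
  assert (R := phi_range q (total l / 2)).
  assert (S : sin (phi q (total l / 2) / 2) <= sin (total (map_ends (phi q) l) / 4)) by (apply sin_incr_1; lra).
  rewrite (sin_half_phi q d Hq Hd Hqd) in S by lra.
  replace (total l / 2 / 2) with (total l / 4) in S by field.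
  apply Rle_div_l in S; [lra|exact Hq].
Qed.

Lemma lead_unshift m y s o F :
  lead m (s * (y * cos (INR (S m) * o) + 0 * sin (INR (S m) * o)))
         (s * (0 * cos (INR (S m) * o) - y * sin (INR (S m) * o))) F ->
  lead m (s * y) 0 (fun t => F (t + - o)).
Proof.
  intros H. apply (lead_shift _ _ _ _ (- o)) in H.
  replace (INR (S m) * - o) with (- (INR (S m) * o)) in H by ring.
  rewrite cos_neg, sin_neg in H. assert (E := sin2_cos2 (INR (S m) * o)). unfold Rsqr in E.
  set (sn := sin (INR (S m) * o)) in *. set (cs := cos (INR (S m) * o)) in *.
  revert H. apply lead_ext; [|ring|reflexivity].
  replace (s * (y * cs + 0 * sn) * cs + s * (0 * cs - y * sn) * - sn) with (s * y * (sn * sn + cs * cs)) by ring.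
  rewrite E. ring.
Qed.

Lemma reframe f lo l c : (forall t, f (t + 2 * PI) = f t) -> chain lo l (lo + 2 * PI) ->
  on_intervals (fun t => Rabs (f t) <= 1) l -> lo <= c <= lo + 2 * PI ->
  exists l', chain (- PI) l' PI /\ total l' = total l /\
    on_intervals (fun t => Rabs (f (t + (c - PI))) <= 1) l'.
Proof.
  intros per Hl Hg Hc.
  destruct (recut (fun t => Rabs (f t) <= 1) lo l c (2 * PI)) as [l' [Hl' [ET Hg']]]; auto.
  { intros t. now rewrite per. }
  exists (map_ends (fun t => t + - (c + PI)) l'). rewrite total_shift. repeat split.
  - apply (chain_shift (- (c + PI))) in Hl'.
    assert (E1 : c + - (c + PI) = - PI) by ring.
    assert (E2 : c + 2 * PI + - (c + PI) = PI) by ring.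
    rewrite E1, E2 in Hl'. exact Hl'.
  - exact ET.
  - apply (on_intervals_shift _ (- (c + PI))) in Hg'.
    intros a b Hab t Ht. assert (Q := Hg' a b Hab t Ht). cbv beta in Q.
    replace (t - - (c + PI)) with (t + (c - PI) + 2 * PI) in Q by ring. now rewrite per in Q.
Qed.

(** The hypothesis on [y] says that [k] divisions by the step ratio bring it to 1 + C M d. Each step
    costs one factor 1 + C M d^3. [M] can be fixed before [k] because a step preserves it. *)
Lemma packing_iterate m : exists C, 0 <= C /\ forall q d M, 0 < q -> 0 < d -> q * q + d * d = 1 -> 1 <= M ->
  forall k f y lo l, lead m y 0 f -> (forall t, Rabs (f t) <= M) ->
  chain lo l (lo + 2 * PI) -> on_intervals (fun t => Rabs (f t) <= 1) l ->
  y <= (1 + C * M * d) * ((1 + C * M * d ^ 3) / (q * q) ^ S m) ^ k ->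
  y * sin (total l / 4) ^ (2 * S m) <= (1 + C * M * d) * (1 + C * M * d ^ 3) ^ k.
Proof.
  destruct (step_frame m) as [C [HC H]]. exists C. split; [exact HC|].
  intros q d M Hq Hd Hqd HM1.
  assert (d3 : 0 < d ^ 3) by now apply pow_lt.
  assert (K1 : 0 <= C * M * d) by (apply Rmult_le_pos; nra).
  assert (K3 : 0 <= C * M * d ^ 3) by (apply Rmult_le_pos; nra).
  assert (qn : 0 < (q * q) ^ S m) by (apply pow_lt; nra).
  assert (P := PI_RGT_0).
  assert (Small : forall k y lo l, chain lo l (lo + 2 * PI) -> y <= 1 + C * M * d ->
     y * sin (total l / 4) ^ (2 * S m) <= (1 + C * M * d) * (1 + C * M * d ^ 3) ^ k).
  { intros k y lo l Hl Hy. assert (T := chain_total _ _ _ Hl).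
    assert (S := sin_quarter (total l) ltac:(lra)).
    assert (S1 : 0 <= sin (total l / 4) ^ (2 * Datatypes.S m)) by (apply pow_le; lra).
    assert (S2 : sin (total l / 4) ^ (2 * Datatypes.S m) <= 1) by (rewrite <- (pow1 (2 * Datatypes.S m)); apply pow_incr; lra).
    assert (S3 : 1 <= (1 + C * M * d ^ 3) ^ k) by (apply pow_R1_Rle; lra).
    apply Rle_trans with (1 + C * M * d); nra. }
  induction k as [|k IH]; intros f y lo l Hf HM Hl Hg Hy;
    (destruct (Rle_dec y (1 + C * M * d)) as [Hle|Hgt]; [eapply Small; eauto|]).
  { simpl in Hy. lra. }
  destruct (trig_max (S m) f lo (lead_trig _ _ _ _ Hf)) as [c [Hc [Hmax Hder]]].
  assert (per : forall t, f (t + 2 * PI) = f t) by (intros; eapply trig_periodic, lead_trig, Hf).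
  destruct (reframe f lo l c per Hl Hg Hc) as [l0 [Hl0 [T0 Hg0]]].
  set (o := c - PI) in *.
  assert (Hlf := lead_shift _ _ _ _ o Hf).
  (* The maximum dominates the leading amplitude, so in this branch it has the height that
     [step_frame] demands. *)
  assert (Hyc : y <= Rabs (f c)).
  { assert (Q := lead_amplitude _ _ _ _ _ Hf Hmax). assert (0 <= Rabs (f c)) by apply Rabs_pos. nra. }
  destruct (H q d M _ _ (fun t => f (t + o)) l0 Hq Hd Hqd HM1 Hlf) as [F [LF [HFM [CF [GF IF]]]]]; auto.
  { apply deriv_shift. unfold o. now replace (PI + (c - PI)) with c by ring. }
  { unfold o. replace (PI + (c - PI)) with c by ring. lra. }
  apply lead_unshift in LF.
  assert (BT := phi_bathtub q d l0 Hq Hd Hqd Hl0 CF IF). rewrite T0 in BT.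
  set (l1 := map_ends (phi q) l0) in *.
  assert (IH' := IH _ _ (- PI + o) (map_ends (fun t => t + o) l1) LF (fun t => HFM (t + - o))).
  rewrite total_shift in IH'.
  assert (T1 := chain_total _ _ _ CF). assert (T := chain_total _ _ _ Hl).
  assert (S1 := sin_quarter (total l1) ltac:(lra)). assert (S := sin_quarter (total l) ltac:(lra)).
  assert (Hfin : (q * q) ^ Datatypes.S m / (1 + C * M * d ^ 3) * y * sin (total l1 / 4) ^ (2 * Datatypes.S m)
     <= (1 + C * M * d) * (1 + C * M * d ^ 3) ^ k).
  { apply IH'.
    - replace (- PI + o + 2 * PI) with (PI + o) by ring. now apply chain_shift.
    - apply (on_intervals_shift _ o) in GF. exact GF.
    - apply (Rmult_le_reg_l ((1 + C * M * d ^ 3) / (q * q) ^ Datatypes.S m)).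
      { apply Rdiv_lt_0_compat; lra. }
      replace ((1 + C * M * d ^ 3) / (q * q) ^ Datatypes.S m * ((q * q) ^ Datatypes.S m / (1 + C * M * d ^ 3) * y))
        with y by (field; split; lra).
      set (r := (1 + C * M * d ^ 3) / (q * q) ^ Datatypes.S m) in *.
      rewrite <- (tech_pow_Rmult r k) in Hy. lra. }
  apply Rle_trans with (y * (q * sin (total l1 / 4)) ^ (2 * Datatypes.S m)).
  { apply Rmult_le_compat_l; [lra|]. apply pow_incr. lra. }
  rewrite Rpow_mult_distr, pow_mult. replace (q ^ 2) with (q * q) by ring.
  apply (Rmult_le_compat_l (1 + C * M * d ^ 3)) in Hfin; [|lra].
  replace ((1 + C * M * d ^ 3) * ((q * q) ^ Datatypes.S m / (1 + C * M * d ^ 3) * y * sin (total l1 / 4) ^ (2 * Datatypes.S m)))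
    with (y * ((q * q) ^ Datatypes.S m * sin (total l1 / 4) ^ (2 * Datatypes.S m))) in Hfin by (field; lra).
  rewrite <- (tech_pow_Rmult (1 + C * M * d ^ 3) k).
  eapply Rle_trans; [exact Hfin|]. right. ring.
Qed.

Lemma exp_pow x k : exp x ^ k = exp (INR k * x).
Proof.
  induction k as [|k IH]; [simpl; now rewrite Rmult_0_l, exp_0|].
  rewrite S_INR, Rmult_plus_distr_r, Rmult_1_l, exp_plus, <- IH. simpl. ring.
Qed.

Lemma one_plus_le_exp x : 1 + x <= exp x.
Proof. destruct (Req_dec x 0) as [->|H]; [rewrite exp_0; lra|]. left. now apply exp_ineq1. Qed.

Lemma packing_zero_phase m y f lo l : lead m y 0 f -> chain lo l (lo + 2 * PI) ->
  on_intervals (fun t => Rabs (f t) <= 1) l -> y * sin (total l / 4) ^ (2 * S m) <= 1.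
Proof.
  intros Hf Hl Hg. destruct (packing_iterate m) as [C [HC H]].
  destruct (trig_max (S m) f 0 (lead_trig _ _ _ _ Hf)) as [c [_ [Hmax _]]].
  set (M := Rmax 1 (Rabs (f c))). assert (HM1 : 1 <= M) by apply Rmax_l.
  assert (HM : forall t, Rabs (f t) <= M) by (intros t; eapply Rle_trans; [apply Hmax|apply Rmax_r]).
  set (Y := y * sin (total l / 4) ^ (2 * S m)).
  destruct (Rle_dec Y 1) as [|Hgt]; [assumption|exfalso].
  destruct (INR_unbounded y) as [K HK].
  set (D := C * M). assert (HD : 0 <= D) by (apply Rmult_le_pos; lra).
  assert (HY : 0 < ln Y) by (rewrite <- ln_1; apply ln_increasing; lra).
  (* [j] makes ln Y exceed the final error exponent D (1 + K) / N; the shift by 2 in [N] gives d <=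
     1/2. *)
  destruct (INR_unbounded (D * (1 + INR K) / ln Y)) as [j Hj].
  set (N := INR (S (S j))).
  assert (HN : 2 <= N) by (unfold N; rewrite !S_INR; assert (0 <= INR j) by apply pos_INR; lra).
  assert (HjN : D * (1 + INR K) < ln Y * N).
  { apply Rlt_div_l in Hj; [|exact HY]. unfold N. rewrite !S_INR. nra. }
  set (d := / N).
  assert (Hd : 0 < d) by (apply Rinv_0_lt_compat; lra).
  assert (HdN : d * N = 1) by (unfold d; field; lra).
  assert (Hd1 : d <= / 2) by (apply Rinv_le_contravar; lra).
  set (q := sqrt (1 - d * d)).
  assert (Hqq : q * q = 1 - d * d) by (apply sqrt_sqrt; nra).
  assert (Hq : 0 < q) by (apply sqrt_lt_R0; nra).
  (* Then k d^2 = K > y, and Bernoulli's inequality gives (1 + d^2)^k > y. This count is cruder than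
     the logarithmic one, but the error exponent D d (1 + K) still tends to 0 with d. *)
  set (k := (K * (S (S j) * S (S j)))%nat).
  assert (Hk : INR k * (d * d) = INR K).
  { unfold k. rewrite !mult_INR. fold N. replace (INR K * (N * N) * (d * d)) with (INR K * ((d * N) * (d * N))) by ring.
    rewrite HdN. ring. }
  assert (d3 : 0 < d ^ 3) by now apply pow_lt.
  assert (Hfin := H q d M Hq Hd ltac:(lra) HM1 k f y lo l Hf HM Hl Hg).
  fold D in Hfin. fold Y in Hfin.
  assert (Dd3 : 0 <= D * d ^ 3) by (apply Rmult_le_pos; lra).
  assert (Hexp : Y <= exp (D * d * (1 + INR K))).
  { apply Rle_trans with ((1 + D * d) * (1 + D * d ^ 3) ^ k).
    - apply Hfin.
      assert (B1 : 1 + d * d <= (1 + D * d ^ 3) / (q * q) ^ S m).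
      { assert (qm : 0 < (q * q) ^ m <= 1).
        { split; [apply pow_lt; nra|]. rewrite <- (pow1 m). apply pow_incr. nra. }
        apply Rle_div_r; [apply pow_lt; nra|].
        apply Rle_trans with 1; [|lra]. rewrite <- tech_pow_Rmult, Hqq.
        rewrite Hqq in qm. set (r := (1 - d * d) ^ m) in *.
        assert (0 <= (1 + d * d) * (1 - d * d) <= 1) by nra. rewrite <- Rmult_assoc. nra. }
      assert (B2 : 1 + INR k * (d * d) <= (1 + d * d) ^ k) by (apply poly; nra).
      rewrite Hk in B2.
      assert (B3 : (1 + d * d) ^ k <= ((1 + D * d ^ 3) / (q * q) ^ S m) ^ k) by (apply pow_incr; nra).
      set (z := ((1 + D * d ^ 3) / (q * q) ^ S m) ^ k) in *.
      assert (K0 := pos_INR K). assert (0 <= D * d * z) by (apply Rmult_le_pos; nra). lra.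
    - replace (D * d * (1 + INR K)) with (D * d + INR k * (D * d ^ 3)).
      2:{ rewrite <- Hk. simpl. ring. }
      rewrite exp_plus, <- exp_pow. apply Rmult_le_compat; [nra|apply pow_le; nra|apply one_plus_le_exp|].
      apply pow_incr. split; [nra|apply one_plus_le_exp]. }
  apply ln_le in Hexp; [|lra]. rewrite ln_exp in Hexp.
  assert (ln Y * N <= D * (1 + INR K)); [|lra].
  replace (D * (1 + INR K)) with (D * d * (1 + INR K) * N).
  - apply Rmult_le_compat_r; lra.
  - replace (D * d * (1 + INR K) * N) with (D * (1 + INR K) * (d * N)) by ring. rewrite HdN. ring.
Qed.

Lemma packing m A B y f lo l : lead m A B f -> A * A + B * B = y * y -> chain lo l (lo + 2 * PI) ->
  on_intervals (fun t => Rabs (f t) <= 1) l -> y * sin (total l / 4) ^ (2 * S m) <= 1.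
Proof.
  intros Hf HAB Hl Hg.
  destruct (Req_dec y 0) as [->|Hy]; [lra|].
  destruct (angle_of_unit (A / y) (B / y)) as [x [Hc Hs]].
  { replace (A / y * (A / y) + B / y * (B / y)) with ((A * A + B * B) / (y * y)) by (field; exact Hy).
    rewrite HAB. field. exact Hy. }
  set (s := x / INR (S m)).
  assert (Es : INR (S m) * s = x) by (unfold s; field; apply Rgt_not_eq, INR_S_pos).
  assert (L := lead_shift _ _ _ _ s Hf). rewrite Es, Hc, Hs in L.
  rewrite <- (total_shift (- s)).
  apply (packing_zero_phase m y (fun t => f (t + s)) (lo + - s)).
  - revert L. apply lead_ext; [|field; exact Hy|reflexivity].
    replace (A * (A / y) + B * (B / y)) with ((A * A + B * B) / y) by (field; exact Hy).
    rewrite HAB. field. exact Hy.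
  - replace (lo + - s + 2 * PI) with (lo + 2 * PI + - s) by ring. now apply chain_shift.
  - apply (on_intervals_shift _ (- s)) in Hg. intros a b Hab t Ht.
    assert (Q := Hg a b Hab t Ht). cbv beta in Q. now replace (t - - s) with (t + s) in Q by ring.
Qed.

(** * Polynomials bounded on an arc of extremal length *)

(** Here q sin t = 2 q sin (t/2) cos (t/2) stands for sin tau. In contrast to [contraction] no
    critical point is assumed, and the sines lose one power of [q] less. *)
Definition folding (q : R) (n : nat) (a b : nat -> R) (t : R) : R :=
  a O / 2 + comb n a b (fun k t => cheb k (q * q * cos t + (1 - q * q)))
                       (fun k t => q * sin t * chebU k (q * q * cos t + (1 - q * q))) t.

Lemma folding_lead q m a b :
  lead m ((q * q) ^ S m * a (S m)) (q * (q * q) ^ m * b (S m)) (folding q (S m) a b).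
Proof.
  apply (comb_lead a b _ _ (fun k => (q * q) ^ S k) (fun k => q * (q * q) ^ k)).
  - intros k. apply cheb_lead.
  - intros k. apply chebU_lead.
Qed.

Lemma folding_trig q n a b : trig n (folding q n a b).
Proof.
  destruct n as [|m]; [|eapply lead_trig, folding_lead].
  apply (trig_ext _ (fun _ => a O / 2)); [|apply trig_const]. intros t. unfold folding. simpl. ring.
Qed.

Definition half_ratio (q t : R) : R := cos (t / 2) / cos (tau q t / 2).

(** Multiplying the odd part by a ratio in [0, 1] is a convex combination of the values at [tau] and
    [- tau], so bounds on the symmetric arc carry over. *)
Lemma folding_convex q n a b t : 0 < q < 1 -> - PI <= t <= PI ->
  0 <= half_ratio q t <= 1 /\
  folding q n a b t = (1 + half_ratio q t) / 2 * trig_poly n a b (tau q t)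
                      + (1 - half_ratio q t) / 2 * trig_poly n a b (- tau q t).
Proof.
  intros Hq Ht. assert (Hq1 : 0 < q <= 1) by lra. unfold half_ratio.
  assert (Z0 := cos_half_tau_pos q t). assert (ZZ := cos_half_tau_sqr q Hq1 t).
  assert (c0 := half_range t Ht). assert (E := sin_cos_half t).
  set (z := cos (tau q t / 2)) in *. set (c := cos (t / 2)) in *. set (s := sin (t / 2)) in *.
  assert (zpos : 0 < z).
  { destruct Z0 as [|Z0]; [assumption|]. rewrite <- Z0 in ZZ. assert (0 < q * q < 1) by nra. nra. }
  assert (cz : c <= z) by (assert (0 < q * q < 1) by nra; apply Rsqr_incr_0_var; [unfold Rsqr; nra|lra]).
  split.
  { split; [apply Rle_div_r; lra|apply Rle_div_l; lra]. }
  assert (Q : forall k, q * sin t * chebU k (q * q * cos t + (1 - q * q)) = c / z * sin (INR k * tau q t)).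
  { intros k. rewrite <- (cos_tau q Hq1), <- chebU_sin, (sin_double_half (tau q t)), (sin_half_tau q Hq1), (sin_double_half t).
    fold s c z. field. lra. }
  assert (C : forall n, comb n a b (fun k t => cheb k (q * q * cos t + (1 - q * q)))
      (fun k t => q * sin t * chebU k (q * q * cos t + (1 - q * q))) t
     = (1 + c / z) / 2 * trig_sum n a b (tau q t) + (1 - c / z) / 2 * trig_sum n a b (- tau q t)).
  { clear n. induction n as [|n IH]; [simpl; ring|]. cbn [comb trig_sum].
    rewrite IH, Q, <- (cos_tau q Hq1), cheb_cos.
    replace (INR (S n) * - tau q t) with (- (INR (S n) * tau q t)) by ring.
    rewrite cos_neg, sin_neg. field. lra. }
  unfold folding, trig_poly. rewrite C. field. lra.
Qed.

(** Folding is triangular with nonzero diagonal: leading coefficients vanish one order at a time. *)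
Lemma folding_inj q n : 0 < q -> forall a b, (forall t, folding q n a b t = 0) ->
  forall t, trig_poly n a b t = 0.
Proof.
  intros Hq. induction n as [|m IH]; intros a b H t.
  - assert (H0 := H 0). unfold folding in H0. unfold trig_poly. simpl in *. lra.
  - assert (L := lead_amplitude _ _ _ _ 0 (folding_lead q m a b)).
    rewrite Rmult_0_l in L.
    assert (qS : 0 < (q * q) ^ S m) by (apply pow_lt; nra).
    assert (qm : 0 < q * (q * q) ^ m) by (apply Rmult_lt_0_compat; [lra|apply pow_lt; nra]).
    assert (L' := L (fun t => Req_le _ _ (eq_trans (f_equal Rabs (H t)) Rabs_R0))).
    assert (Z : forall x y, x * x + y * y <= 0 -> x = 0 /\ y = 0) by (intros; split; nra).
    apply Z in L'. destruct L' as [La Lb].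
    apply Rmult_integral in La. apply Rmult_integral in Lb.
    assert (Ea : a (S m) = 0) by (destruct La as [La|La]; [lra|exact La]).
    assert (Eb : b (S m) = 0) by (destruct Lb as [Lb|Lb]; [lra|exact Lb]).
    assert (H' : forall s, folding q m a b s = 0).
    { intros s. rewrite <- (H s). unfold folding. cbn [comb]. rewrite Ea, Eb. ring. }
    assert (I := IH a b H' t). unfold trig_poly in *. cbn [trig_sum]. rewrite Ea, Eb. lra.
Qed.

Lemma tau_in_arc q t : 0 < q < 1 -> - (2 * asin q) <= tau q t <= 2 * asin q.
Proof.
  intros Hq. assert (R := tau_range q t). assert (b := asin_bound q).
  assert (S := SIN_bound (t / 2)).
  assert (E : sin (asin q) = q) by (apply sin_asin; lra).
  assert (T := sin_half_tau q ltac:(lra) t). split.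
  - cut (- asin q <= tau q t / 2); [lra|]. apply sin_incr_0; try lra. rewrite sin_neg, E, T. nra.
  - cut (tau q t / 2 <= asin q); [lra|]. apply sin_incr_0; try lra. rewrite E, T. nra.
Qed.

Lemma arc_rigidity m q A B y f : 0 < q < 1 -> lead m A B f -> A * A + B * B = y * y ->
  y * (q * q) ^ S m = 1 ->
  (forall t, - (2 * asin q) <= t <= 2 * asin q -> Rabs (f t) <= 1) ->
  B = 0 /\ exists eps, eps * eps = 1 /\ A = eps * y /\
    forall t, f t = eps * cheb (S m) (/ (q * q) * cos t + (1 - / (q * q))).
Proof.
  intros Hq Hf HAB Hy Harc.
  destruct (lead_trig _ _ _ _ Hf) as [a0 [b0 Hab0]].
  assert (Hex : exists a b, a (S m) = A /\ b (S m) = B /\ forall t, f t = trig_poly (S m) a b t).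
  { destruct Hf as [g [[a [b Hg]] Hf]].
    exists (fun k => if Nat.eqb k (S m) then A else a k), (fun k => if Nat.eqb k (S m) then B else b k).
    rewrite Nat.eqb_refl. repeat split. intros t. rewrite Hf, Hg. unfold trig_poly. cbn [trig_sum].
    rewrite Nat.eqb_refl. change (Nat.eqb 0 (S m)) with false. cbv iota.
    rewrite (trig_sum_ext m a b (fun k => if Nat.eqb k (S m) then A else a k) (fun k => if Nat.eqb k (S m) then B else b k)); [ring|].
    intros k Hk. rewrite (proj2 (Nat.eqb_neq k (S m))) by lia. auto. }
  clear a0 b0 Hab0. destruct Hex as [a [b [Ea [Eb Hab]]]].
  assert (LF := folding_lead q m a b). rewrite Ea, Eb in LF.
  assert (HF : forall t, Rabs (folding q (S m) a b t) <= 1).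
  { intros t. destruct (trig_period_reduce (S m) _ (- PI) t (folding_trig q (S m) a b)) as [s [Hs ->]].
    destruct (folding_convex q (S m) a b s Hq ltac:(lra)) as [Hl ->].
    assert (R := tau_in_arc q s Hq).
    assert (F1 := Harc (tau q s) R). assert (F2 := Harc (- tau q s) ltac:(lra)).
    rewrite Hab in F1, F2. apply Rabs_le_between in F1. apply Rabs_le_between in F2.
    apply Rabs_le. split; nra. }
  assert (Amp := lead_amplitude _ _ _ _ _ LF HF).
  assert (qq : 0 < q * q < 1) by nra.
  assert (qm : 0 < (q * q) ^ m) by (apply pow_lt; lra).
  rewrite <- tech_pow_Rmult in *. set (r := (q * q) ^ m) in *.
  (* With n = m + 1, [Amp] reads q^(4n) A^2 + q^(4n-2) B^2 <= 1 = q^(4n) (A^2 + B^2), which leaves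
     (1 - q^2) B^2 <= 0. *)
  assert (HB : B = 0).
  { assert (E1 : 1 = (q * q * r) * (q * q * r) * (A * A + B * B)).
    { rewrite HAB. replace (q * q * r * (q * q * r) * (y * y)) with ((y * (q * q * r)) * (y * (q * q * r))) by ring.
      rewrite Hy. ring. }
    assert (E2 : (q * q * (1 - q * q) * (r * r)) * (B * B) <= 0) by nra.
    assert (0 < q * q * (1 - q * q) * (r * r)) by (apply Rmult_lt_0_compat; nra).
    assert (B * B <= 0) by nra. nra. }
  split; [exact HB|]. subst B. rewrite HB in *.
  set (eps := q * q * r * A).
  assert (He : eps * eps = 1).
  { unfold eps. replace (q * q * r * A * (q * q * r * A)) with (q * q * r * (q * q * r) * (A * A + 0 * 0)) by ring.
    rewrite HAB. replace (q * q * r * (q * q * r) * (y * y)) with ((y * (q * q * r)) * (y * (q * q * r))) by ring.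
    rewrite Hy. ring. }
  exists eps. split; [exact He|]. split.
  { unfold eps. replace (q * q * r * A * y) with ((y * (q * q * r)) * A) by ring. rewrite Hy. ring. }
  assert (LF' : lead m eps 0 (folding q (S m) a b)).
  { revert LF. apply lead_ext; [reflexivity|ring|reflexivity]. }
  assert (EF := lead_extremal m eps _ He LF' HF).
  set (Y := / (q * q)).
  set (g := fun t => cheb (S m) (Y * cos t + (1 - Y))).
  assert (Tg : trig (S m) g) by (eapply lead_trig, cheb_lead).
  (* [f] and [eps g] fold to the same function, so the difference folds to zero and injectivity
     applies. *)
  assert (Th : trig (S m) (fun t => f t + (- eps) * g t)).
  { apply trig_lin; [eapply lead_trig, Hf|exact Tg]. }
  destruct Th as [a' [b' Hh]].
  assert (Hz : forall t, folding q (S m) a' b' t = 0).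
  { intros t. destruct (trig_period_reduce (S m) _ (- PI) t (folding_trig q (S m) a' b')) as [s [Hs ->]].
    assert (Hs' : - PI <= s <= PI) by lra.
    destruct (folding_convex q (S m) a' b' s Hq Hs') as [_ ->].
    rewrite <- !Hh.
    assert (Gt : g (tau q s) = cos (INR (S m) * s)).
    { unfold g. rewrite (cos_tau q) by lra. rewrite <- cheb_cos. f_equal. unfold Y. field. lra. }
    assert (Gn : g (- tau q s) = cos (INR (S m) * s)) by (rewrite <- Gt; unfold g; now rewrite cos_neg).
    rewrite Gt, Gn.
    assert (FE := EF s). destruct (folding_convex q (S m) a b s Hq Hs') as [_ E].
    rewrite E, <- !Hab in FE. lra. }
  intros t. assert (Z := folding_inj q (S m) ltac:(lra) a' b' Hz t). rewrite <- Hh in Z.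
  fold (g t). lra.
Qed.

(** * The extremal set is an arc *)

Lemma sin_lipschitz x y : Rabs (sin x - sin y) <= Rabs (x - y).
Proof.
  assert (H : forall x y, x <= y -> Rabs (sin x - sin y) <= y - x).
  { clear. intros x y Hxy. apply Rabs_le. split.
    - cut (0 <= (y - sin y) - (x - sin x)); [lra|]. apply Rge_le, Rge_minus, Rle_ge.
      apply (nondecreasing_of_deriv (fun t => t - sin t) (fun t => 1 - cos t)); [exact Hxy| |].
      + intros t _. apply is_derive_Reals. auto_derive; [exact I|ring].
      + intros t _. assert (C := COS_bound t). lra.
    - cut (0 <= (y + sin y) - (x + sin x)); [lra|]. apply Rge_le, Rge_minus, Rle_ge.
      apply (nondecreasing_of_deriv (fun t => t + sin t) (fun t => 1 + cos t)); [exact Hxy| |].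
      + intros t _. apply is_derive_Reals. auto_derive; [exact I|ring].
      + intros t _. assert (C := COS_bound t). lra. }
  destruct (Rle_dec x y) as [Hxy|Hxy].
  - rewrite (Rabs_left1 (x - y)) by lra. replace (- (x - y)) with (y - x) by ring. auto.
  - rewrite Rabs_minus_sym, (Rabs_right (x - y)) by lra. apply H. lra.
Qed.

Lemma cos_lower h : 1 - h * h / 2 <= cos h.
Proof.
  rewrite cos_double_half.
  assert (H := sin_lipschitz (h / 2) 0). rewrite sin_0, !Rminus_0_r in H.
  assert (Q := Rsqr_le_abs_1 _ _ H). unfold Rsqr in Q. lra.
Qed.

Lemma sin_lower h : 0 <= h <= 1 -> h / 2 <= sin h.
Proof.
  intros Hh. cut (0 - 0 / 2 <= sin h - h / 2); [lra|]. rewrite <- sin_0 at 1.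
  apply (nondecreasing_of_deriv (fun t => sin t - t / 2) (fun t => cos t - / 2)); [lra| |].
  - intros t _. apply is_derive_Reals. auto_derive; [exact I|]. field.
  - intros t Ht. assert (C := cos_lower t). nra.
Qed.

Lemma exceed_nbhd f p : continuity f -> 1 < Rabs (f p) ->
  exists del, 0 < del /\ forall t, Rabs (t - p) < del -> 1 < Rabs (f t).
Proof.
  intros Hc H.
  assert (Hc' : continuity_pt (fun t => Rabs (f t)) p).
  { apply (continuity_pt_comp f Rabs); [apply Hc|apply Rcontinuity_abs]. }
  destruct (Hc' (Rabs (f p) - 1)) as [del [Hdel HD]]; [lra|].
  exists del. split; [exact Hdel|]. intros t Ht. destruct (Req_dec t p) as [->|Hne]; [exact H|].
  assert (Q := HD t). unfold dist in Q. simpl in Q. unfold R_dist in Q.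
  assert (Q' : Rabs (Rabs (f t) - Rabs (f p)) < Rabs (f p) - 1).
  { apply Q. repeat split; auto. }
  apply Rabs_def2 in Q'. lra.
Qed.

Lemma exceed_interval f p R : continuity f -> 0 < R -> - R <= p <= R -> 1 < Rabs (f p) ->
  exists u v, - R < u /\ u < v /\ v < R /\ forall t, u <= t <= v -> 1 < Rabs (f t).
Proof.
  intros Hc HR Hp H. destruct (exceed_nbhd f p Hc H) as [del [Hdel N]].
  set (e := Rmin (del / 3) (R / 3)).
  assert (E1 : e <= del / 3) by apply Rmin_l. assert (E2 : e <= R / 3) by apply Rmin_r.
  assert (E0 : 0 < e) by (unfold e; apply Rmin_glb_lt; lra).
  destruct (Rle_dec p 0) as [p0|p0].
  - exists (p + e), (p + 2 * e). repeat split; try lra.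
    intros t Ht. apply N. apply Rabs_def1; lra.
  - exists (p - 2 * e), (p - e). repeat split; try lra.
    intros t Ht. apply N. apply Rabs_def1; lra.
Qed.

Lemma chain_in_gap u l v P : chain u l v -> on_intervals P l -> (forall t, u <= t <= v -> ~ P t) -> l = [].
Proof.
  intros Hl HP HN. destruct l as [|[a b] l]; [reflexivity|exfalso].
  destruct (chain_in _ _ _ a b Hl) as [H1 [H2 H3]]; [now left|].
  apply (HN a); [lra|]. apply (HP a b); [now left|lra].
Qed.

Lemma map_ends_app h l l' : map_ends h (l ++ l') = map_ends h l ++ map_ends h l'.
Proof. apply map_app. Qed.

Lemma Rlt_Rminus_0 a b : a < b -> 0 < b - a.
Proof. lra. Qed.

Lemma on_intervals_app_inv P l l' : on_intervals P (l ++ l') -> on_intervals P l /\ on_intervals P l'.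
Proof. intros H. split; intros a b Hin; apply (H a b), in_or_app; auto. Qed.

Lemma small_positive a b c e f : 0 < a -> 0 < b -> 0 < c -> 0 < e -> 0 < f ->
  exists d, 0 < d /\ d < a /\ d < b /\ d < c /\ d < e /\ d < f.
Proof.
  intros. set (x := Rmin a (Rmin b (Rmin c (Rmin e f)))).
  assert (x1 : x <= a) by apply Rmin_l.
  assert (X : x <= Rmin b (Rmin c (Rmin e f))) by apply Rmin_r.
  assert (x2 := Rmin_l b (Rmin c (Rmin e f))). assert (X2 := Rmin_r b (Rmin c (Rmin e f))).
  assert (x3 := Rmin_l c (Rmin e f)). assert (X3 := Rmin_r c (Rmin e f)).
  assert (x4 := Rmin_l e f). assert (X4 := Rmin_r e f).
  assert (0 < x) by (unfold x; repeat apply Rmin_glb_lt; assumption).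
  exists (x / 2). repeat split; lra.
Qed.

Lemma pow_le_inv x y n : 0 <= y -> x ^ S n <= y ^ S n -> x <= y.
Proof.
  intros Hy H. destruct (Rle_dec x y) as [|Hn]; [assumption|exfalso].
  assert (P : forall k, y ^ S k < x ^ S k).
  { induction k as [|k IH]; [simpl; lra|].
    rewrite <- (tech_pow_Rmult y), <- (tech_pow_Rmult x).
    apply Rle_lt_trans with (y * x ^ S k); [apply Rmult_le_compat_l; lra|].
    apply Rmult_lt_compat_r; [|lra]. apply Rle_lt_trans with (y ^ S k); [now apply pow_le|exact IH]. }
  assert (Q := P n). lra.
Qed.

(* A point [p] of the arc with [|f p| > 1] forces the set [|f| <= 1] to leave the arc, and then one
   contraction step gains length of order [d^2], which beats its error of order [d^3]. *)
Lemma extremal_arc m q0 A B y f : 0 < q0 < 1 -> lead m A B f -> A * A + B * B = y * y -> 1 < y ->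
  y * (q0 * q0) ^ S m = 1 ->
  (forall t, Rabs (f t) <= Rabs (f PI)) -> derivable_pt_lim f PI 0 ->
  (forall eta, 0 < eta -> exists l, chain (- PI) l PI /\ on_intervals (fun t => Rabs (f t) <= 1) l /\
     4 * asin q0 - eta <= total l) ->
  forall t, - (2 * asin q0) <= t <= 2 * asin q0 -> Rabs (f t) <= 1.
Proof.
  intros Hq0 Hf HAB Hy Hyq Hmax Hder Hlen p Hp.
  destruct (Rle_dec (Rabs (f p)) 1) as [|Hp1]; [assumption|exfalso].
  assert (P := PI_RGT_0). assert (bq := asin_bound q0).
  assert (Sq : sin (asin q0) = q0) by (apply sin_asin; lra).
  set (R := 2 * asin q0) in *.
  assert (HR : 0 < R).
  { destruct (Rle_dec (asin q0) 0) as [H|H]; [|unfold R; lra].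
    assert (sin (asin q0) <= 0) by (rewrite <- sin_0; apply sin_incr_1; lra). lra. }
  destruct (exceed_interval f p R) as [u [v [Hu [Huv [Hv Hexc]]]]]; auto; try lra.
  { eapply trig_continuity, lead_trig, Hf. }
  set (m0 := Rmax (Rabs u) (Rabs v)).
  assert (mu : Rabs u <= m0) by apply Rmax_l. assert (mv : Rabs v <= m0) by apply Rmax_r.
  assert (m0R : 0 <= m0 < R).
  { split; [eapply Rle_trans; [apply Rabs_pos|exact mu]|].
    unfold m0. apply Rmax_lub_lt; apply Rabs_def1; lra. }
  assert (RPI : R <= PI) by (unfold R; lra).
  (* A radius strictly between the hole and the end of the arc. The half-length [x0] will exceed it,
     so the weight at [x0] beats the weight on [[u, v]] by a fixed multiple of d^2. *)
  set (x1 := (m0 + R) / 2).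
  assert (cm0 : cos (x1 / 2) < cos (m0 / 2)) by (apply cos_decreasing_1; unfold x1; lra).
  assert (cx1 : 0 < cos (x1 / 2)) by (apply cos_gt_0; unfold x1; lra).
  set (G := / (cos (x1 / 2) * cos (x1 / 2)) - / (cos (m0 / 2) * cos (m0 / 2))).
  assert (HG : 0 < G).
  { unfold G. apply Rlt_Rminus_0, Rinv_lt_contravar; [|nra].
    apply Rmult_lt_0_compat; nra. }
  (* The 1/8 is the 1/2 of [phi'_gain] times the 1/4 of L/4. *)
  set (e0 := G * (v - u) / 8). assert (He0 : 0 < e0) by (unfold e0; nra).
  destruct (step_frame m) as [C [HC HS]].
  assert (HM : forall M, M = Rabs (f PI) -> y <= M).
  { intros M ->. assert (Q := lead_amplitude _ _ _ _ _ Hf Hmax).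
    assert (0 <= Rabs (f PI)) by apply Rabs_pos. nra. }
  set (M := Rabs (f PI)) in *. specialize (HM M eq_refl).
  set (D := C * M). assert (HD : 0 <= D) by (apply Rmult_le_pos; lra).
  set (c0 := (1 - q0 * q0) / 2). assert (Hc0 : 0 < c0 < 1) by (unfold c0; nra).
  (* In turn these give q >= 1/2; cos (phi x0 / 2) >= c0; x0 >= x1 and h <= 1; 1 + D d < y; and the
     final contradiction. *)
  destruct (small_positive (/ 2) c0 (Rmin (R - m0) (/ (e0 + 1))) ((y - 1) / (D + 1)) (c0 * e0 / (4 * (e0 * e0 + D + 1))))
    as [d [Hd [Hd1 [Hd2 [Hd3 [Hd4 Hd5]]]]]]; try lra.
  { apply Rmin_glb_lt; [lra|]. apply Rinv_0_lt_compat; lra. }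
  { apply Rdiv_lt_0_compat; lra. }
  { apply Rdiv_lt_0_compat; nra. }
  assert (Hd3a : d < R - m0) by (eapply Rlt_le_trans; [exact Hd3|apply Rmin_l]).
  assert (Hd3b : d < / (e0 + 1)) by (eapply Rlt_le_trans; [exact Hd3|apply Rmin_r]).
  apply Rlt_div_r in Hd4; [|lra]. apply Rlt_div_r in Hd5; [|nra].
  assert (Hde : d * e0 <= 1).
  { apply (Rmult_lt_compat_r (e0 + 1)) in Hd3b; [|lra]. rewrite Rinv_l in Hd3b by lra. nra. }
  set (q := sqrt (1 - d * d)).
  assert (Hqq : q * q = 1 - d * d) by (apply sqrt_sqrt; nra).
  assert (Hq : 0 < q) by (apply sqrt_lt_R0; nra).
  assert (Hqd : q * q + d * d = 1) by lra.
  assert (Hqh : / 2 <= q) by nra.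
  assert (d3 : 0 < d ^ 3) by now apply pow_lt.
  assert (d3' : d ^ 3 = d * (d * d)) by ring.
  assert (bB := two_asin_range q d Hq Hd Hqd).
  (* The defect in length is taken of the order of the step error, below the gain of order d^2. *)
  destruct (Hlen (d ^ 3) d3) as [l0 [Hl0 [Hg0 HL]]].
  destruct (chain_split (fun t => Rabs (f t) <= 1) u (- PI) l0 PI Hl0 Hg0 ltac:(lra)) as [l1 [l' [C1 [C' [Tl [G1 G']]]]]].
  destruct (chain_split (fun t => Rabs (f t) <= 1) v u l' PI C' G' ltac:(lra)) as [lm [l2 [Cm [C2 [Tl' [Gm G2]]]]]].
  assert (Elm : lm = []).
  { apply (chain_in_gap u lm v _ Cm Gm). intros t Ht Hle. assert (Q := Hexc t Ht). cbv beta in Hle. lra. }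
  subst lm. simpl in Tl'.
  assert (Hl : chain (- PI) (l1 ++ l2) PI).
  { apply (chain_app _ _ u); [exact C1|]. eapply chain_weaken; [|exact C2]. lra. }
  assert (Hg : on_intervals (fun t => Rabs (f t) <= 1) (l1 ++ l2)) by now apply on_intervals_app.
  assert (ET : total (l1 ++ l2) = total l1 + total l2) by apply total_app.
  assert (EM : total (map_ends (phi q) (l1 ++ l2)) = total (map_ends (phi q) l1) + total (map_ends (phi q) l2))
    by (rewrite map_ends_app; apply total_app).
  set (l := l1 ++ l2) in *.
  destruct (HS q d M A B f l Hq Hd Hqd ltac:(lra) Hf Hmax Hder) as [F [LF [_ [CF [GF IF]]]]]; auto.
  { fold D M. nra. }
  fold D in LF.
  assert (Pk0 := packing m A B y f (- PI) l Hf HAB).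
  replace (- PI + 2 * PI) with PI in Pk0 by ring. specialize (Pk0 Hl Hg).
  set (s := (q * q) ^ S m / (1 + D * d ^ 3)) in *.
  assert (Pk1 := packing m _ _ (s * y) F (- PI) (map_ends (phi q) l) LF).
  replace (- PI + 2 * PI) with PI in Pk1 by ring.
  specialize (Pk1 ltac:(replace (s * A * (s * A) + s * B * (s * B)) with (s * s * (A * A + B * B)) by ring; rewrite HAB; ring) CF GF).
  assert (T0 := chain_total _ _ _ Hl). assert (T1 := chain_total _ _ _ CF).
  assert (T2 := total_interior _ _ _ _ (proj1 bB) Hl IF).
  assert (S0 := sin_quarter (total l) ltac:(lra)).
  assert (S1 := sin_quarter (total (map_ends (phi q) l)) ltac:(lra)).
  assert (Dd : 0 <= D * d ^ 3) by (apply Rmult_le_pos; lra).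
  assert (Ub0 : sin (total l / 4) <= q0).
  { apply (pow_le_inv _ _ (2 * m + 1)); [lra|]. replace (S (2 * m + 1)) with (2 * S m)%nat by lia.
    apply (Rmult_le_reg_l y); [lra|]. rewrite (pow_mult q0). replace (q0 ^ 2) with (q0 * q0) by ring. lra. }
  assert (Ub1 : q * sin (total (map_ends (phi q) l) / 4) <= q0 * (1 + D * d ^ 3)).
  { apply (pow_le_inv _ _ (2 * m + 1)); [nra|]. replace (S (2 * m + 1)) with (2 * S m)%nat by lia.
    rewrite !Rpow_mult_distr. rewrite (pow_mult q), (pow_mult q0).
    replace (q0 ^ 2) with (q0 * q0) by ring. replace (q ^ 2) with (q * q) by ring.
    apply (Rmult_le_reg_l y); [lra|]. rewrite <- (Rmult_assoc y ((q0 * q0) ^ S m)), Hyq, Rmult_1_l.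
    apply Rle_trans with (1 + D * d ^ 3).
    - unfold s in Pk1. apply (Rmult_le_compat_l (1 + D * d ^ 3)) in Pk1; [|lra].
      rewrite Rmult_1_r in Pk1. eapply Rle_trans; [|exact Pk1]. right. field. lra.
    - rewrite <- (Rmult_1_r (1 + D * d ^ 3)) at 1.
      replace (2 * S m)%nat with (S (2 * m + 1)) by lia. rewrite <- tech_pow_Rmult.
      apply Rmult_le_compat_l; [lra|]. apply pow_R1_Rle. lra. }
  destruct (on_intervals_app_inv _ _ _ IF) as [I1 I2].
  set (x0 := total l / 2).
  assert (Hx0 : x1 <= x0) by (unfold x0, x1; unfold R in *; nra).
  assert (Hx0R : x0 <= R).
  { destruct (Rle_dec x0 R) as [|Hn]; [assumption|exfalso].
    assert (sin (asin q0) < sin (total l / 4)); [|lra]. apply sin_increasing_1; unfold R, x0 in *; lra. }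
  assert (Q := bathtub_hole (phi q) (phi' d) (2 * asin q) l1 l2 u v x0 (proj1 bB)
    (phi_deriv q d Hq Hd Hqd) (phi'_mono q d Hq Hd Hqd) (phi_odd q Hq) ltac:(lra) ltac:(unfold x0; lra)).
  apply Rabs_le_between in mu. apply Rabs_le_between in mv.
  specialize (Q ltac:(unfold x1 in *; lra) ltac:(lra) ltac:(unfold x1 in *; lra) C1 C2 I1 I2).
  assert (Hx0B : x0 < 2 * asin q) by (unfold x0; lra).
  assert (Gain : 4 * (d * d * e0) <= phi' d x0 * (v - u) - (phi q v - phi q u)).
  { assert (W1 : phi q v - phi q u <= phi' d m0 * (v - u)).
    { cut (phi' d m0 * u - phi q u <= phi' d m0 * v - phi q v); [lra|].
      apply (nondecreasing_of_deriv (fun t => phi' d m0 * t - phi q t) (fun t => phi' d m0 - phi' d t)); [lra| |].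
      - intros t Ht. apply derivable_pt_lim_minus.
        + rewrite <- (Rmult_1_r (phi' d m0)) at 2. apply (derivable_pt_lim_scal (fun t => t)), derivable_pt_lim_id.
        + apply (phi_deriv q d Hq Hd Hqd). unfold x1 in *. lra.
      - intros t Ht. cut (phi' d t <= phi' d m0); [lra|].
        apply (phi'_mono q d Hq Hd Hqd); rewrite (Rabs_right m0) by lra; [|unfold x1 in *; lra].
        apply Rabs_le. lra. }
    assert (W2 : phi' d x1 <= phi' d x0).
    { apply (phi'_mono q d Hq Hd Hqd); rewrite !Rabs_right by (unfold x1 in *; lra); lra. }
    assert (W3 : phi' d m0 + d * d / 2 * G <= phi' d x1).
    { apply (phi'_gain q d Hq Hd Hqd); rewrite !Rabs_right by (unfold x1 in *; lra); unfold x1 in *; lra. }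
    unfold e0. replace (4 * (d * d * (G * (v - u) / 8))) with (d * d / 2 * G * (v - u)) by field. nra. }
  set (h := d * d * e0) in *.
  set (U := sin (x0 / 2) / q).
  assert (Sphi : sin (phi q x0 / 2) = U).
  { apply (sin_half_phi q d Hq Hd Hqd). unfold x1 in *. lra. }
  assert (Rphi := phi_range q x0).
  assert (Hh : 0 <= h <= 1) by (unfold h; split; nra).
  assert (K1 : sin (phi q x0 / 2 + h) <= sin (total (map_ends (phi q) l) / 4)).
  { apply sin_incr_1; lra. }
  assert (Ux : sin (x0 / 2) = sin (total l / 4)) by (unfold x0; f_equal; field).
  assert (HU : 0 <= U /\ U * q <= q0).
  { unfold U. rewrite Ux. split; [apply Rmult_le_pos; [lra|left; now apply Rinv_0_lt_compat]|].
    replace (sin (total l / 4) / q * q) with (sin (total l / 4)) by (field; lra). lra. }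
  assert (HUc : c0 <= cos (phi q x0 / 2)).
  { assert (E := sin_cos_half (phi q x0)). rewrite Sphi in E.
    assert (Cp := half_range _ Rphi).
    assert (U * U * (q * q) <= q0 * q0) by (replace (U * U * (q * q)) with ((U * q) * (U * q)) by ring; apply Rmult_le_compat; nra).
    apply Rsqr_incr_0_var; [|exact Cp]. unfold Rsqr.
    assert (c0 * c0 <= 1 - U * U); [|lra]. unfold c0 in *. nra. }
  rewrite sin_plus, Sphi in K1.
  assert (Lc := cos_lower h). assert (Ls := sin_lower h Hh).
  assert (K2 : q0 - d ^ 3 / 4 <= U * q).
  { unfold U. replace (sin (x0 / 2) / q * q) with (sin (x0 / 2)) by (field; lra).
    assert (Lip := sin_lipschitz (asin q0) (x0 / 2)). rewrite Sq in Lip.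
    apply Rabs_le_between in Lip. rewrite Rabs_right in Lip by (unfold R in *; lra).
    unfold x0 in *. lra. }
  assert (K3 : U - h * h / 2 + c0 * h / 2 <= sin (total (map_ends (phi q) l) / 4)).
  { eapply Rle_trans; [|exact K1].
    assert (U1 : U <= 1) by (rewrite <- Sphi; apply SIN_bound).
    assert (U * (1 - h * h / 2) <= U * cos h) by (apply Rmult_le_compat_l; lra).
    assert (c0 * (h / 2) <= cos (phi q x0 / 2) * sin h) by (apply Rmult_le_compat; lra).
    assert (U * (h * h) <= h * h) by nra. lra. }
  assert (K4 : q * (c0 * h / 2 - h * h / 2) <= q0 * (D * d ^ 3) + d ^ 3 / 4) by nra.
  assert (K5 : q * (c0 * h / 2 - h * h / 2) <= (D + 1) * d ^ 3).
  { assert (q0 * (D * d ^ 3) <= 1 * (D * d ^ 3)) by (apply Rmult_le_compat_r; lra). lra. }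
  (* Division by d^2 leaves c0 e0 / 2, which is independent of d, against terms that are small with
     d. *)
  assert (K6 : c0 * e0 / 2 - d * d * (e0 * e0) / 2 <= 2 * ((D + 1) * d)).
  { apply (Rmult_le_reg_l (d * d)); [now apply Rmult_lt_0_compat|].
    replace (d * d * (c0 * e0 / 2 - d * d * (e0 * e0) / 2)) with (c0 * h / 2 - h * h / 2) by (unfold h; field).
    replace (d * d * (2 * ((D + 1) * d))) with (2 * ((D + 1) * d ^ 3)) by ring.
    set (w := c0 * h / 2 - h * h / 2) in *.
    assert (0 <= (D + 1) * d ^ 3) by (apply Rmult_le_pos; lra).
    destruct (Rle_dec w 0) as [|Hw]; [lra|].
    assert (/ 2 * w <= q * w) by (apply Rmult_le_compat_r; lra). lra. }
  assert (K7 : d * d * (e0 * e0) <= d * (e0 * e0)).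
  { apply Rmult_le_compat_r; [apply Rle_0_sqr|]. rewrite <- (Rmult_1_r d) at 3. apply Rmult_le_compat_l; lra. }
  assert (0 <= d * (e0 * e0)) by (apply Rmult_le_pos; [lra|apply Rle_0_sqr]).
  replace (d * (4 * (e0 * e0 + D + 1))) with (4 * (d * (e0 * e0)) + 4 * ((D + 1) * d)) in Hd5 by ring. lra.
Qed.

(** * Riemann integrals of the indicators *)

Lemma bound_closure f a b : continuity f -> a < b -> (forall t, a < t < b -> Rabs (f t) <= 1) ->
  forall t, a <= t <= b -> Rabs (f t) <= 1.
Proof.
  intros Hc Hab H t Ht. destruct (Rle_dec (Rabs (f t)) 1) as [|Hn]; [assumption|exfalso].
  destruct (exceed_nbhd f t Hc) as [del [Hdel N]]; [lra|].
  set (e := Rmin (del / 2) ((b - a) / 3)).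
  assert (E1 : e <= del / 2) by apply Rmin_l. assert (E2 : e <= (b - a) / 3) by apply Rmin_r.
  assert (E0 : 0 < e) by (unfold e; apply Rmin_glb_lt; lra).
  destruct (Rle_dec t ((a + b) / 2)) as [h|h].
  - assert (Q := N (t + e)). assert (Q' := H (t + e)).
    assert (Rabs (t + e - t) < del) by (apply Rabs_def1; lra). specialize (Q ltac:(assumption)). lra.
  - assert (Q := N (t - e)). assert (Q' := H (t - e)).
    assert (Rabs (t - e - t) < del) by (apply Rabs_def1; lra). specialize (Q ltac:(assumption)). lra.
Qed.

Lemma ind_ge1_cases f t : (ind_ge1 f t = 1 /\ 1 <= Rabs (f t)) \/ (ind_ge1 f t = 0 /\ Rabs (f t) < 1).
Proof. unfold ind_ge1. destruct Rle_dec; [left|right]; split; auto; lra. Qed.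

(** A piece with value below 1 has no interior point with |f| >= 1 and joins the list, its closure
    by continuity. Any other piece is no longer than its integral. *)
Lemma step_function_intervals f g b : continuity f -> forall l a lf, a <= b -> adapted_couple g a b l lf ->
  (forall t, a <= t <= b -> ind_ge1 f t <= g t) ->
  exists L, chain a L b /\ on_intervals (fun t => Rabs (f t) <= 1) L /\ (b - a) - Int_SF lf l <= total L.
Proof.
  intros Hf. induction l as [|r1 l IH]; intros a lf Hab Had Hg.
  - destruct Had as [_ [_ [_ [H _]]]]. discriminate.
  - destruct l as [|r2 l].
    + destruct Had as [_ [H1 [H2 [H3 _]]]]. simpl in *.
      rewrite Rmin_left in H1 by exact Hab. rewrite Rmax_right in H2 by exact Hab.
      exists []. destruct lf; [|discriminate]. simpl. repeat split; try lra. intros x z [].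
    + destruct lf as [|r3 lf]; [destruct Had as [_ [_ [_ [H _]]]]; discriminate|].
      assert (Had' := StepFun_P7 Hab Had).
      destruct Had as [Hord [H1 [_ [_ Hcst]]]].
      simpl in H1. rewrite Rmin_left in H1 by exact Hab. subst r1.
      assert (O1 : a <= r2) by (apply (Hord 0%nat); simpl; lia).
      assert (O2 : r2 <= b).
      { destruct Had' as [_ [H2 _]]. simpl in H2. rewrite H2. apply Rmin_r. }
      destruct (IH r2 lf O2 Had') as [L [CL [GL TL]]]; [intros; apply Hg; lra|].
      assert (Hc0 := Hcst 0%nat ltac:(simpl; lia)). simpl in Hc0.
      unfold constant_D_eq, open_interval in Hc0.
      change (Int_SF (r3 :: lf) (a :: r2 :: l)) with (r3 * (r2 - a) + Int_SF lf (r2 :: l)).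
      destruct (Req_dec a r2) as [E|NE].
      { exists L. rewrite E. repeat split; auto. lra. }
      assert (V : forall t, a < t < r2 -> ind_ge1 f t <= r3).
      { intros t Ht. rewrite <- (Hc0 t Ht). apply Hg. lra. }
      destruct (Rlt_dec r3 1) as [h|h].
      * exists ((a, r2) :: L). simpl. repeat split; try lra; auto.
        -- apply on_intervals_cons. split; [|exact GL].
           apply bound_closure; [exact Hf|lra|]. intros t Ht. assert (Q := V t Ht).
           destruct (ind_ge1_cases f t) as [[E _]|[_ E]]; lra.
        -- assert (Q := V ((a + r2) / 2) ltac:(lra)).
           assert (0 <= r3) by (destruct (ind_ge1_cases f ((a + r2) / 2)) as [[E _]|[E _]]; lra). nra.
      * exists L. repeat split; auto; [eapply chain_weaken; eauto|]. nra.
Qed.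

(** A Riemann approximant plus its error function is a step function above the indicator, with
    integral below [x + eta]. *)
Lemma mu_is_intervals f x eta : continuity f -> mu_is f x -> 0 < eta ->
  exists L, chain 0 L (2 * PI) /\ on_intervals (fun t => Rabs (f t) <= 1) L /\ 2 * PI - x - eta <= total L.
Proof.
  intros Hf [pr Hx] He. assert (P := PI_RGT_0).
  unfold RiemannInt in Hx. destruct (RiemannInt_exists pr RinvN RinvN_cv) as [x' Hcv]. subst x'.
  destruct (Hcv (eta / 2)) as [N1 HN1]; [lra|].
  assert (HR : Un_cv (fun N => RinvN N) 0) by apply RinvN_cv.
  destruct (HR (eta / 2)) as [N2 HN2]; [lra|].
  set (N := max N1 N2).
  specialize (HN1 N ltac:(unfold N; lia)). specialize (HN2 N ltac:(unfold N; lia)).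
  unfold Rdist in *. rewrite Rminus_0_r in HN2. apply Rabs_def2 in HN1. apply Rabs_def2 in HN2.
  destruct (phi_sequence_prop RinvN pr N) as [psi [Hpsi1 Hpsi2]]. apply Rabs_def2 in Hpsi2.
  set (ph := phi_sequence RinvN pr N) in *.
  set (S := mkStepFun (StepFun_P28 1 ph psi)).
  assert (ES : RiemannInt_SF S = RiemannInt_SF ph + 1 * RiemannInt_SF psi) by apply StepFun_P30.
  destruct (step_function_intervals f S (2 * PI) Hf (subdivision S) 0 (subdivision_val S)) as [L [CL [GL TL]]].
  - lra.
  - apply StepFun_P1.
  - intros t Ht. simpl. assert (Q := Hpsi1 t). rewrite Rmin_left, Rmax_right in Q by lra.
    specialize (Q Ht). apply Rabs_le_between in Q. lra.
  - exists L. repeat split; auto.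
    replace (Int_SF (subdivision_val S) (subdivision S)) with (RiemannInt_SF S) in TL.
    + lra.
    + unfold RiemannInt_SF. destruct Rle_dec; [reflexivity|lra].
Qed.

Lemma is_RInt_finite_support l : forall g a b, a <= b ->
  (forall t, a < t < b -> ~ In t l -> g t = 0) -> is_RInt g a b 0.
Proof.
  induction l as [|p l IH]; intros g a b Hab Hg.
  - apply is_RInt_ext with (fun _ => 0).
    + intros t. rewrite Rmin_left, Rmax_right by exact Hab. intros Ht. rewrite Hg; auto.
    + assert (H := is_RInt_const a b 0). unfold scal in H. simpl in H. unfold mult in H. simpl in H.
      now rewrite Rmult_0_r in H.
  - destruct (Rlt_dec a p) as [h1|h1]; [destruct (Rlt_dec p b) as [h2|h2]|].
    + assert (H1 : is_RInt g a p 0).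
      { apply IH; [lra|]. intros t Ht Hn. apply Hg; [lra|]. intros [->|Hin]; [lra|auto]. }
      assert (H2 : is_RInt g p b 0).
      { apply IH; [lra|]. intros t Ht Hn. apply Hg; [lra|]. intros [->|Hin]; [lra|auto]. }
      assert (H := is_RInt_Chasles g a p b 0 0 H1 H2). unfold plus in H. simpl in H.
      now rewrite Rplus_0_r in H.
    + apply IH; [exact Hab|]. intros t Ht Hn. apply Hg; [lra|]. intros [->|Hin]; [lra|auto].
    + apply IH; [exact Hab|]. intros t Ht Hn. apply Hg; [lra|]. intros [->|Hin]; [lra|auto].
Qed.

Lemma is_RInt_translate (g : R -> R) s a b v : is_RInt g (a + s) (b + s) v -> is_RInt (fun t => g (t + s)) a b v.
Proof.
  intros H. assert (H' := is_RInt_comp_lin g 1 s a b v).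
  rewrite !Rmult_1_l in H'. specialize (H' H).
  revert H'. apply is_RInt_ext. intros t _. unfold scal. simpl. unfold mult. simpl. now rewrite !Rmult_1_l.
Qed.

Lemma is_RInt_period (g : R -> R) T a v : 0 < T -> (forall t, g (t + T) = g t) ->
  is_RInt g a (a + T) v -> is_RInt g 0 T v.
Proof.
  intros HT Hg H. destruct (period_reduce 0 T a HT) as [s [Hs [z E]]].
  assert (H1 : is_RInt g s (s + T) v).
  { assert (Q := is_RInt_translate g (IZR z * T) s (s + T) v). rewrite <- E in Q.
    replace (s + T + IZR z * T) with (a + T) in Q by (rewrite E; ring).
    revert H. intros H. apply Q in H. revert H. apply is_RInt_ext. intros t _. now apply periodic_Z. }
  assert (X1 : ex_RInt g s T).
  { apply (ex_RInt_Chasles_1 (V := R_CompleteNormedModule) g s T (s + T)); [lra|]. now exists v. }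
  assert (X2 : ex_RInt g T (s + T)).
  { apply (ex_RInt_Chasles_2 (V := R_CompleteNormedModule) g s T (s + T)); [lra|]. now exists v. }
  destruct X1 as [v1 I1]. destruct X2 as [v2 I2].
  assert (Ev := is_RInt_unique _ _ _ _ H1).
  rewrite (is_RInt_unique _ _ _ _ (is_RInt_Chasles g s T (s + T) v1 v2 I1 I2)) in Ev.
  assert (I3 : is_RInt g 0 s v2).
  { assert (Q := is_RInt_translate g T 0 s v2). rewrite Rplus_0_l in Q. specialize (Q I2).
    revert Q. apply is_RInt_ext. intros t _. apply Hg. }
  assert (I4 := is_RInt_Chasles g 0 s T v2 v1 I3 I1).
  rewrite <- Ev. unfold plus in *. simpl in *. now rewrite Rplus_comm.
Qed.

Lemma cheb_ge1 n x : 1 <= x -> 1 <= cheb n x.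
Proof.
  intros Hx. cut (1 <= cheb n x /\ cheb n x <= cheb (S n) x); [tauto|].
  induction n as [|n [H1 H2]]; [simpl; lra|].
  change (cheb (S (S n)) x) with (2 * x * cheb (S n) x - cheb n x). split; [lra|nra].
Qed.

Lemma cheb_opp n x : cheb n (- x) = (-1) ^ n * cheb n x.
Proof.
  induction n as [| |n A B] using two_step_ind.
  - simpl. ring.
  - simpl. ring.
  - change (cheb (S (S n)) (- x)) with (2 * - x * cheb (S n) (- x) - cheb n (- x)).
    change (cheb (S (S n)) x) with (2 * x * cheb (S n) x - cheb n x).
    rewrite A, B. simpl pow. ring.
Qed.

(* Off the arc the argument is at most -1; on the arc [|T_n| = 1] only at the points [cos (j pi / n)]. *)
Lemma ind_cheb_integral m q : 0 < q < 1 ->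
  is_RInt (ind_ge1 (fun t => cheb (S m) (/ (q * q) * cos t + (1 - / (q * q)))))
     (- (2 * asin q)) (- (2 * asin q) + 2 * PI) (2 * PI - 4 * asin q).
Proof.
  intros Hq. assert (P := PI_RGT_0). assert (ba := asin_bound q).
  assert (Sq : sin (asin q) = q) by (apply sin_asin; lra).
  set (Y := / (q * q)). assert (qq : 0 < q * q < 1) by nra.
  assert (HY : Y * (q * q) = 1) by (unfold Y; field; lra).
  assert (Y1 : 1 < Y) by (unfold Y; rewrite <- Rinv_1; apply Rinv_lt_contravar; lra).
  assert (be : 0 < asin q < PI / 2).
  { split.
    - destruct (Rle_dec (asin q) 0) as [H|H]; [|lra].
      assert (sin (asin q) <= 0) by (rewrite <- sin_0; apply sin_incr_1; lra). lra.
    - destruct (Rlt_dec (asin q) (PI / 2)) as [H|H]; [lra|].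
      replace (asin q) with (PI / 2) in Sq by lra. rewrite sin_PI2 in Sq. lra. }
  set (r := 2 * asin q).
  set (g := fun t => cheb (S m) (Y * cos t + (1 - Y))).
  assert (I1 : is_RInt (ind_ge1 g) (- r) r 0).
  (* The exceptional points solve Y cos t + 1 - Y = cos (j pi / (m + 1)) for j = 0, ..., m + 1, with
     both signs of t. *)
  { apply (is_RInt_finite_support (flat_map (fun j => let c := acos ((cos (INR j * PI / INR (S m)) + Y - 1) / Y) in [c; - c])
       (seq 0 (S (S m))))); [unfold r; lra|].
    intros t Ht Hn. destruct (ind_ge1_cases g t) as [[_ E]|[E _]]; [exfalso; apply Hn|exact E].
    assert (Hs : - q < sin (t / 2) < q).
    { rewrite <- Sq at 2. rewrite <- Sq at 1. rewrite <- sin_neg.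
      unfold r in Ht. split; apply sin_increasing_1; lra. }
    set (u := Y * cos t + (1 - Y)) in *.
    assert (Hu : -1 <= u <= 1).
    { unfold u. rewrite cos_double_half. set (s := sin (t / 2)) in *.
      assert (0 <= Y * (s * s) <= 1).
      { split; [apply Rmult_le_pos; [lra|apply Rle_0_sqr]|]. rewrite <- HY. apply Rmult_le_compat_l; [lra|]. nra. }
      lra. }
    set (ph := acos u). assert (Hph := acos_bound u). fold ph in Hph.
    assert (Eu : cos ph = u) by now apply cos_acos.
    unfold g in E. fold u in E. rewrite <- Eu, cheb_cos in E.
    assert (Es : sin (INR (S m) * ph) = 0).
    { assert (Q := sin2_cos2 (INR (S m) * ph)). unfold Rsqr in Q.
      assert (Q' : 1 <= cos (INR (S m) * ph) * cos (INR (S m) * ph)).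
      { set (x := cos (INR (S m) * ph)) in *.
        replace (x * x) with (Rabs x * Rabs x) by (rewrite <- Rabs_mult; apply Rabs_right, Rle_ge, Rle_0_sqr). nra. }
      nra. }
    destruct (sin_eq_0_0 _ Es) as [z Hz].
    assert (Pm := INR_S_pos m).
    assert (Z0 : (0 <= z)%Z).
    { apply le_IZR. apply (Rmult_le_reg_r PI); [lra|]. rewrite <- Hz, Rmult_0_l. apply Rmult_le_pos; lra. }
    assert (Z1 : (z <= Z.of_nat (S m))%Z).
    { apply le_IZR. rewrite <- INR_IZR_INZ. apply (Rmult_le_reg_r PI); [lra|]. rewrite <- Hz.
      apply Rmult_le_compat_l; lra. }
    apply in_flat_map. exists (Z.to_nat z). split; [apply in_seq; lia|].
    assert (Ez : INR (Z.to_nat z) * PI / INR (S m) = ph).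
    { rewrite INR_IZR_INZ, Z2Nat.id by exact Z0. rewrite <- Hz. field. lra. }
    rewrite Ez, Eu.
    replace ((u + Y - 1) / Y) with (cos t) by (unfold u; field; lra).
    destruct (Rle_dec 0 t) as [h|h].
    - left. apply acos_cos. unfold r in Ht. lra.
    - right. left. rewrite <- cos_neg, acos_cos; [ring|]. unfold r in Ht. lra. }
  assert (I2 : is_RInt (ind_ge1 g) r (- r + 2 * PI) (2 * PI - 2 * r)).
  { apply is_RInt_ext with (fun _ => 1).
    - intros t. rewrite Rmin_left, Rmax_right by (unfold r; lra). intros Ht.
      destruct (ind_ge1_cases g t) as [[E _]|[_ E]]; [now rewrite E|exfalso].
      assert (Hs : q < sin (t / 2)).
      { destruct (Rle_dec (t / 2) (PI / 2)) as [h|h].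
        - rewrite <- Sq. apply sin_increasing_1; unfold r in *; lra.
        - rewrite <- Sq, <- (sin_PI_x (t / 2)). apply sin_increasing_1; unfold r in *; lra. }
      assert (Hu : 1 <= - (Y * cos t + (1 - Y))).
      { rewrite cos_double_half. set (s := sin (t / 2)) in *.
        assert (1 <= Y * (s * s)); [|lra]. rewrite <- HY. apply Rmult_le_compat_l; nra. }
      assert (Q := cheb_ge1 (S m) _ Hu). rewrite cheb_opp in Q.
      assert (Q' := Rle_trans _ _ _ Q (Rle_abs _)). rewrite Rabs_pow_m1 in Q'. unfold g in E. lra.
    - assert (H := is_RInt_const r (- r + 2 * PI) 1). unfold scal in H. simpl in H. unfold mult in H. simpl in H.
      replace (2 * PI - 2 * r) with ((- r + 2 * PI - r) * 1) by ring. exact H. }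
  assert (I := is_RInt_Chasles _ _ _ _ _ _ I1 I2). unfold plus in I. simpl in I.
  replace (2 * PI - 4 * asin q) with (0 + (2 * PI - 2 * r)) by (unfold r; ring). exact I.
Qed.

(** * The extremal polynomials *)

Section Extremal.
Variables (m : nat) (y : R).
Hypothesis Hy : 1 < y.

(** The value of sin (L/4) at equality: y q^(2n) = 1, and the claimed minimum 4 acos q is what an
    arc of length 4 asin q leaves of the circle. *)
Let q : R := 1 / Rpower y (/ (2 * INR (S m))).

Lemma Rpower_root : Rpower y (/ INR (S m)) = / (q * q).
Proof.
  unfold q. assert (Pm := INR_S_pos m). assert (P := exp_pos (/ (2 * INR (S m)) * ln y)).
  change (exp (/ (2 * INR (S m)) * ln y)) with (Rpower y (/ (2 * INR (S m)))) in P.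
  replace (/ INR (S m)) with (/ (2 * INR (S m)) + / (2 * INR (S m))) by (field; lra).
  rewrite Rpower_plus. field. lra.
Qed.

Lemma q_range : 0 < q < 1.
Proof.
  unfold q. assert (Pm := INR_S_pos m).
  assert (P : 1 < Rpower y (/ (2 * INR (S m)))).
  { rewrite <- (Rpower_O y) by lra. apply Rpower_lt; [exact Hy|]. apply Rinv_0_lt_compat. lra. }
  split; [apply Rdiv_lt_0_compat; lra|]. apply Rlt_div_l; lra.
Qed.

Lemma y_pow : (/ (q * q)) ^ S m = y.
Proof.
  rewrite <- Rpower_root, <- Rpower_pow by apply exp_pos. rewrite Rpower_mult.
  rewrite Rinv_l by (apply Rgt_not_eq, INR_S_pos). apply Rpower_1. lra.
Qed.

Lemma y_q : y * (q * q) ^ S m = 1.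
Proof.
  assert (Q := q_range). rewrite <- y_pow, <- Rpow_mult_distr, Rinv_l by nra. apply pow1.
Qed.

Lemma sigma_eq : 4 * acos q = 2 * PI - 4 * asin q.
Proof. rewrite acos_asin; [field|]. assert (Q := q_range). lra. Qed.

Lemma fnk_eq k t : fnk (S m) y k t =
  (-1) ^ k * cheb (S m) (/ (q * q) * cos (t - PI * INR k / INR (S m)) + (1 - / (q * q))).
Proof. unfold fnk. rewrite Rpower_root. do 2 f_equal. ring. Qed.

Lemma fnk_lead k : lead m y 0 (fnk (S m) y k).
Proof.
  assert (L := cheb_lead (/ (q * q)) m). rewrite y_pow in L.
  apply (lead_shift _ _ _ _ (- (PI * INR k / INR (S m)))) in L.
  apply (lead_scal _ _ _ _ ((-1) ^ k)) in L.
  replace (INR (S m) * - (PI * INR k / INR (S m))) with (- (INR k * PI)) in L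
    by (field; apply Rgt_not_eq, INR_S_pos).
  rewrite cos_neg, sin_neg, cos_INR_PI, sin_INR_PI in L.
  revert L. apply lead_ext; [|ring|].
  - replace ((-1) ^ k * (y * (-1) ^ k + 0 * - 0)) with (((-1) ^ k * (-1) ^ k) * y) by ring.
    rewrite pow_m1_sqr. ring.
  - intros t. now rewrite fnk_eq.
Qed.

Lemma fnk_mu k : mu_is (fnk (S m) y k) (4 * acos q).
Proof.
  assert (P := PI_RGT_0).
  set (g := fun t => cheb (S m) (/ (q * q) * cos t + (1 - / (q * q)))).
  set (s := PI * INR k / INR (S m)).
  assert (I : is_RInt (ind_ge1 (fnk (S m) y k)) 0 (2 * PI) (4 * acos q)).
  { rewrite sigma_eq. apply (is_RInt_period _ _ (- (2 * asin q) + s)); [lra| |].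
    - intros t. unfold ind_ge1. now rewrite (trig_periodic _ _ t (lead_trig _ _ _ _ (fnk_lead k))).
    - assert (Q := is_RInt_translate (ind_ge1 g) (- s) (- (2 * asin q) + s) (- (2 * asin q) + s + 2 * PI) (2 * PI - 4 * asin q)).
      replace (- (2 * asin q) + s + - s) with (- (2 * asin q)) in Q by ring.
      replace (- (2 * asin q) + s + 2 * PI + - s) with (- (2 * asin q) + 2 * PI) in Q by ring.
      specialize (Q (ind_cheb_integral m q q_range)).
      revert Q. apply is_RInt_ext. intros t _. unfold ind_ge1. rewrite fnk_eq.
      fold s. rewrite Rabs_pow_m1. reflexivity. }
  assert (X : ex_RInt (ind_ge1 (fnk (S m) y k)) 0 (2 * PI)) by (eexists; exact I).
  exists (ex_RInt_Reals_0 _ _ _ X). rewrite <- RInt_Reals. now apply is_RInt_unique.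
Qed.

(** A smaller measure would leave intervals with |f| <= 1 of total length above 4 asin q, against
    the packing inequality. *)
Lemma mu_lower f x : lead m y 0 f -> mu_is f x -> 4 * acos q <= x.
Proof.
  intros Hf Hx. destruct (Rle_dec (4 * acos q) x) as [|Hn]; [assumption|exfalso].
  assert (P := PI_RGT_0). assert (Q := q_range). assert (ba := asin_bound q).
  assert (Sq : sin (asin q) = q) by (apply sin_asin; lra).
  assert (Hc : continuity f) by (eapply trig_continuity, lead_trig, Hf).
  destruct (mu_is_intervals f x ((4 * acos q - x) / 2) Hc Hx) as [L [CL [GL TL]]]; [lra|].
  assert (T := chain_total _ _ _ CL).
  replace (2 * PI) with (0 + 2 * PI) in CL by ring.
  assert (Pk := packing_zero_phase m y f 0 L Hf CL GL).
  assert (S0 := sin_quarter (total L) ltac:(lra)).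
  assert (sin (total L / 4) <= q).
  { apply (pow_le_inv _ _ (2 * m + 1)); [lra|]. replace (S (2 * m + 1)) with (2 * S m)%nat by lia.
    apply (Rmult_le_reg_l y); [lra|]. rewrite (pow_mult q). replace (q ^ 2) with (q * q) by ring.
    rewrite y_q. exact Pk. }
  assert (q < sin (total L / 4)); [|lra].
  rewrite <- Sq. rewrite sigma_eq in *. apply sin_increasing_1; lra.
Qed.

Lemma cos_Z_PI z w k : z = (2 * w + Z.of_nat k)%Z -> cos (IZR z * PI) = (-1) ^ k.
Proof.
  intros ->. rewrite <- cos_INR_PI, plus_IZR, mult_IZR, <- INR_IZR_INZ.
  replace ((2 * IZR w + INR k) * PI) with (INR k * PI + IZR w * (2 * PI)) by ring.
  apply (periodic_Z cos). intros t. rewrite cos_plus, cos_2PI, sin_2PI. ring.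
Qed.

Lemma mu_unique f : lead m y 0 f -> mu_is f (4 * acos q) ->
  exists k, (k < 2 * S m)%nat /\ forall t, f t = fnk (S m) y k t.
Proof.
  intros Hf Hmu. assert (P := PI_RGT_0). assert (Q := q_range).
  assert (Hc : continuity f) by (eapply trig_continuity, lead_trig, Hf).
  assert (per : forall t, f (t + 2 * PI) = f t) by (intros; eapply trig_periodic, lead_trig, Hf).
  destruct (trig_max (S m) f 0 (lead_trig _ _ _ _ Hf)) as [c [Hcr [Hmax Hder]]].
  set (o := c - PI).
  assert (Lf := lead_shift _ _ _ _ o Hf).
  assert (Eo : PI + o = c) by (unfold o; ring).
  assert (E := sin2_cos2 (INR (S m) * o)). unfold Rsqr in E.
  set (A := y * cos (INR (S m) * o) + 0 * sin (INR (S m) * o)) in *.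
  set (B := 0 * cos (INR (S m) * o) - y * sin (INR (S m) * o)) in *.
  assert (HAB : A * A + B * B = y * y) by (unfold A, B; nra).
  assert (Harc : forall t, - (2 * asin q) <= t <= 2 * asin q -> Rabs (f (t + o)) <= 1).
  { apply (extremal_arc m q A B y (fun t => f (t + o)) Q Lf HAB Hy y_q).
    - intros t. rewrite Eo. apply Hmax.
    - apply deriv_shift. now rewrite Eo.
    - intros eta Heta. destruct (mu_is_intervals f _ eta Hc Hmu Heta) as [L [CL [GL TL]]].
      replace (2 * PI) with (0 + 2 * PI) in CL by ring.
      destruct (reframe f 0 L c per CL GL Hcr) as [l [Cl [Tl Gl]]].
      exists l. repeat split; auto. rewrite Tl, sigma_eq in *. lra. }
  destruct (arc_rigidity m q A B y _ Q Lf HAB y_q Harc) as [HB [eps [He [HA Hform]]]].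
  (* The vanishing sine coefficient in the rotated frame makes the rotation a multiple of pi / n. *)
  assert (Hs : sin (INR (S m) * o) = 0) by (unfold B in HB; nra).
  destruct (sin_eq_0_0 _ Hs) as [z Hz].
  assert (Pm := INR_S_pos m).
  set (n2 := (2 * Z.of_nat (S m))%Z). assert (Hn2 : (0 < n2)%Z) by (unfold n2; lia).
  (* The quotient counts full turns; since the modulus 2n is even, [k] keeps the parity of [z] and
     hence the sign. *)
  set (k := Z.to_nat (z mod n2)). set (w := (z / n2)%Z).
  assert (Hk := Z.mod_pos_bound z n2 Hn2).
  assert (Ek : Z.of_nat k = (z mod n2)%Z) by (unfold k; lia).
  assert (Ezw : z = (2 * (Z.of_nat (S m) * w) + Z.of_nat k)%Z).
  { rewrite Ek. unfold w. rewrite (Z.div_mod z n2) at 1 by lia. unfold n2. ring. }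
  exists k. split; [unfold n2 in *; lia|]. intros t.
  assert (Heps : eps = (-1) ^ k).
  { rewrite <- (cos_Z_PI z _ k Ezw), <- Hz. unfold A in HA. nra. }
  assert (Eo' : o = PI * INR k / INR (S m) + IZR w * (2 * PI)).
  { assert (Ho : o = IZR z * PI / INR (S m)) by (rewrite <- Hz; field; lra).
    rewrite Ho, Ezw, plus_IZR, !mult_IZR, <- !INR_IZR_INZ. field. lra. }
  rewrite fnk_eq. replace t with ((t - o) + o) at 1 by ring. rewrite Hform, Heps.
  do 4 f_equal. rewrite Eo'.
  rewrite <- (periodic_Z cos (2 * PI)) with (z := w); [f_equal; ring|].
  intros x. rewrite cos_plus, cos_2PI, sin_2PI. ring.
Qed.
End Extremal.

Theorem theorem1 (n : nat) (y : R) (hn : (1 <= n)%nat) (hy : 1 < y) :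
  is_sigma n y (4 * acos (1 / Rpower y (/ (2 * INR n)))) /\
  (forall k : nat, (k < 2 * n)%nat ->
     in_Fny n y (fnk n y k) /\ mu_is (fnk n y k) (4 * acos (1 / Rpower y (/ (2 * INR n))))) /\
  (forall f : R -> R, in_Fny n y f ->
     mu_is f (4 * acos (1 / Rpower y (/ (2 * INR n)))) ->
     exists k : nat, (k < 2 * n)%nat /\ forall t, f t = fnk n y k t).
Proof.
  destruct n as [|m]; [lia|].
  assert (HF : forall k, in_Fny (S m) y (fnk (S m) y k)) by (intros k; now apply in_Fny_lead, fnk_lead).
  repeat split.
  - intros x [f [Hf Hx]]. apply in_Fny_lead in Hf. now apply (mu_lower m y hy f).
  (* The infimum is attained, for instance at k = 0. *)
  - intros b Hb. apply Hb. exists (fnk (S m) y 0). split; [apply HF|now apply fnk_mu].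
  - apply HF.
  - now apply fnk_mu.
  - intros f Hf Hx. apply in_Fny_lead in Hf. now apply mu_unique.
Qed.
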